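(* Let $\alpha\ge 0$ be real and let $k\ge 1$ be an integer. For every $x\in[\xi_{k-1},\xi_k]$, \[ R_k^{(\alpha,\alpha)}(x)=\min_{n\ge 0}R_n^{(\alpha,\alpha)}(x), \] where the minimum is over all integers $n\ge 0$.
   Context: For real $a,b>-1$ and integers $n\ge 0$, $R_n^{(a,b)}(x)=P_n^{(a,b)}(x)/P_n^{(a,b)}(1)$, where $P_n^{(a,b)}$ is the Jacobi polynomial of degree $n$ (orthogonal on $[-1,1]$ with respect to the weight $(1-x)^a(1+x)^b$). For the fixed $\alpha\ge 0$, put $\xi_0=-1$, and for $n\ge 1$ let $\xi_n$ be the largest zero of $R_n^{(\alpha+1,\alpha)}$. (It is classical that $-1=\xi_0<\xi_1<\xi_2<\cdots<1$ and $\xi_n\to 1$.) *)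

(* Defs.v *)
From mathcomp Require Import all_boot all_order all_algebra.
From mathcomp Require Import all_classical all_reals all_analysis.

Set Implicit Arguments.
Unset Strict Implicit.
Unset Printing Implicit Defensive.

Import Order.TTheory GRing.Theory Num.Theory.
Import numFieldNormedType.Exports.

Local Open Scope classical_set_scope.
Local Open Scope ring_scope.

Definition jacobi_weight (R : realType) (a b x : R) : R :=
  (1 - x) `^ a * (1 + x) `^ b.

(* Szego's definition of the Jacobi polynomials: orthogonality together with
   P n 1 = binom(n + a, n), the product below.  For a, b > -1 all the
   integrands are integrable and exactly one sequence P satisfies this. *)
Definition is_jacobi (R : realType) (a b : R) (P : nat -> {poly R}) : Prop :=
  [/\ forall n, size (P n) = n.+1,
      forall m n, m != n ->
        (\int[lebesgue_measure]_(x in `[(-1)%R, 1%R])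
           ((P m).[x] * (P n).[x] * jacobi_weight a b x)%R%:E = 0)%E
    & forall n, (P n).[1] = \prod_(i < n) ((a + i.+1%:R) / i.+1%:R)].

(* Meaningful for a, b > -1, where is_jacobi has a unique solution. *)
Definition jacobi (R : realType) (a b : R) : nat -> {poly R} :=
  xget (fun=> 0) [set P | is_jacobi a b P].

Definition jacobiR (R : realType) (a b : R) (n : nat) : {poly R} :=
  ((jacobi a b n).[1])^-1 *: jacobi a b n.

Definition is_largest_zero (R : realType) (p : {poly R}) (z : R) : Prop :=
  root p z /\ forall y, root p y -> y <= z.

Definition largest_zero (R : realType) (p : {poly R}) : R :=
  xget 0 [set z | is_largest_zero p z].

Definition xi (R : realType) (alpha : R) (n : nat) : R :=
  if n is 0 then -1 else largest_zero (jacobiR (alpha + 1) alpha n).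

Definition is_minimum (R : realType) (A : set R) (m : R) : Prop :=
  A m /\ forall y, A y -> m <= y.

(* Main.v *)
Require Import Defs.
From mathcomp Require Import all_boot all_order all_algebra.
From mathcomp Require Import all_classical all_reals all_analysis.
From mathcomp Require Import ring lra.

(** Put l = alpha + 1/2 and u_n = R_n^(alpha,alpha)(x). The numbers u_n
    satisfy u_0 = 1, u_1 = x and
      (n + 1 + 2 l) u_(n+2) = 2 (n + 1 + l) x u_(n+1) - (n + 1) u_n,
    and u_n - u_(n+1) is 1 - x times a polynomial [ujac l n] proportional to
    R_n^(alpha+1,alpha). For x between xi_(k-1) and xi_k the first k
    differences are therefore nonnegative, x being beyond the largest zeros
    of the polynomials concerned. The difference of index k is nonpositive:
    the earlier polynomials are nonnegative at x and at xi_k, which fixes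
    the sign of the Casoratian of their values at these two points
    ([ujac_le0]). So u decreases up to the index k, which is its first
    trough, and what has to be shown is that no later term falls below u_k
    ([trough_min]).

    The tool is the energy E_n = u_n^2 + u_(n+1)^2 - 2 x u_n u_(n+1). It
    decreases with n ([energyS]) and dominates (1 - x^2) u_n^2, so the claim
    follows for all n >= m once E_m <= (1 - x^2) u_k^2 ([energy_tail]). At
    the trough itself E_k exceeds this bound by (u_(k+1) - x u_k)^2, and
    this excess has to be burnt before u returns to negative values. The two
    inequalities defining a trough bound the excess ([trough_defect]). How
    the loss is found depends on x.

    - For 0 <= x < 4/5 and k >= 3 the two steps following k suffice
      ([trough_two_step]). The losses are large when l is comparable with k.
      When l is small, k is at most 8: comparison of the differences with an
      explicit supersolution of their recurrence shows that (1 - x) k^2 is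
      bounded in terms of l along a decreasing stretch ([bump_super],
      [trough_index_le]); each remaining k is a numerical check.

    - For x >= 4/5 and k >= 3 many steps are needed. A term of index above k below u_k
      would be preceded by a sign change at some N. Before N the sequence
      increases, hence stays above u_k; across N the energy drops by the
      factor (N / (N + 2 l))^2 ([crossing_energy]), which is enough if N is
      not too large. That N is not too large follows from the lower bounds
      on the increments of a negative stretch ([crossing_before]) together
      with the same bound on k.

    - For x <= 0 only k = 1 and k = 2 occur, and the terms up to u_7 are
      explicit. In the variables m = 2 l - 1 >= 0 and Z = (m + 3)^2 x^2
      everything becomes a family of polynomial inequalities on intervals of
      Z, proved by expanding in the Bernstein basis ([bernstein_outer] and
      the following). The inequality is sharp here: for alpha = 0 and x =
      -1/3 one has u_1 = u_2 = u_5. For k = 2 and x > 0 the two-step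
      argument works again ([trough2_pos]).

    It remains to connect the recurrences with the Jacobi polynomials, which
    are defined by orthogonality. The recurrence polynomials satisfy the
    ultraspherical differential equation ([ultra_ode]), hence (1 -
    x^2)^(alpha+1) times the Wronskian of two of them is a primitive of a
    multiple of their product times the weight, and it vanishes at both ends
    ([ultra_orth]). Summation by parts carries orthogonality over to [ujac]
    ([ujac_orth]), and a sequence of orthogonal polynomials is unique up to
    scalars ([orth_unique]). *)

Set Implicit Arguments.
Unset Strict Implicit.
Unset Printing Implicit Defensive.

Import Order.TTheory GRing.Theory Num.Theory.
Import numFieldNormedType.Exports.

Local Open Scope classical_set_scope.
Local Open Scope ring_scope.

(** Nonvanishing of denominators that are positive by linear arithmetic,
    as left over by [field]. *)
Ltac nz := do ?[apply/andP; split]; try (apply: lt0r_neq0; lra).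

(** * The normalized ultraspherical recurrence and its energy *)

Section Energy.
Variable R : realFieldType.
Implicit Types (l x : R) (u : nat -> R) (n : nat).

Lemma le_sqr (a b : R) : 0 <= a -> a <= b -> a ^+ 2 <= b ^+ 2.
Proof. by move=> a0 ab; rewrite ler_sqr ?nnegrE//; exact: le_trans ab. Qed.

(** The sign of the left-hand side is left free: rational upper bounds for
    square roots are applied to expressions that may be negative. *)
Lemma le_of_sqr (a b : R) : 0 <= b -> a ^+ 2 <= b ^+ 2 -> a <= b.
Proof.
move=> b0 h; rewrite leNgt; apply/negP => ba.
suff : b ^+ 2 < a ^+ 2 by rewrite ltNge h.
by rewrite ltr_sqr ?nnegrE// (le_trans b0)// ltW.
Qed.

(** The recurrence of the ultraspherical polynomials of parameter l,
    normalized to take the value 1 at 1; l = alpha + 1/2, so alpha >= 0 reads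
    l >= 1/2. *)
Definition ultra_seq l x u : Prop :=
  [/\ 1 / 2 <= l, u 0%N = 1, u 1%N = x &
    forall n, (n.+1%:R + 2 * l) * u n.+2 =
      2 * (n.+1%:R + l) * x * u n.+1 - n.+1%:R * u n].

(** For l = 0 the recurrence is that of cos (n t) with x = cos t, and this
    quadratic form is its constant of motion, sin^2 t. *)
Definition energy x u n := u n ^+ 2 + u n.+1 ^+ 2 - 2 * x * u n * u n.+1.

(** Written as (n + 1 + l) (u_(n+2) - 2 x u_(n+1) + u_n) =
    - l (u_(n+2) - u_n), the recurrence is a discrete oscillator with
    friction; multiplying by u_(n+2) - u_n gives the energy balance. *)
Lemma energyS l x u n : ultra_seq l x u ->
  energy x u n.+1 = energy x u n - l / (n.+1%:R + l) * (u n.+2 - u n) ^+ 2.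
Proof.
move=> [hl _ _ uS].
have n0 : 0 <= n%:R :> R by [].
have nl : n.+1%:R + l != 0 by apply: lt0r_neq0; lra.
have e : u n.+2 + u n - 2 * x * u n.+1 = - (l / (n.+1%:R + l)) * (u n.+2 - u n).
  apply: (mulfI nl); have := uS n; move: (u n.+2) (u n.+1) (u n) => a b c h.
  rewrite mulrA mulrN (mulrCA _ l) mulfV // mulr1; lra.
transitivity (energy x u n + (u n.+2 - u n) * (u n.+2 + u n - 2 * x * u n.+1)).
  rewrite /energy; ring.
by rewrite e /energy; ring.
Qed.

Lemma energy_le l x u m n : ultra_seq l x u -> (m <= n)%N ->
  energy x u n <= energy x u m.
Proof.
move=> hu /subnK <-; elim: (n - m)%N => // k ih; rewrite addSn (energyS _ hu).
case: hu => hl _ _ _.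
apply: le_trans ih; rewrite gerBl mulr_ge0 ?sqr_ge0// divr_ge0//; first lra.
by rewrite addr_ge0//; lra.
Qed.

Lemma energy_ge x u n : (1 - x ^+ 2) * u n ^+ 2 <= energy x u n.
Proof.
rewrite /energy -subr_ge0.
by rewrite [X in 0 <= X](_ : _ = (u n.+1 - x * u n) ^+ 2) ?sqr_ge0//; ring.
Qed.

(** The way every lower bound for a tail of the sequence is obtained: energy
    decreases and controls each term. *)
Lemma energy_tail l x u m n (v : R) : ultra_seq l x u -> 0 <= v -> x ^+ 2 < 1 ->
  energy x u m <= (1 - x ^+ 2) * v ^+ 2 -> (m <= n)%N -> - v <= u n.
Proof.
move=> hu v0 x1 Em mn.
rewrite lerNl; apply: le_of_sqr => //; rewrite sqrrN.
rewrite -(@ler_pM2l _ (1 - x ^+ 2)) ?subr_gt0//.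
exact: le_trans (energy_ge _ _ _) (le_trans (energy_le hu mn) Em).
Qed.

(** The algebraic core of the two-step argument. With v = - u_k and
    e = u_(k+1) - x u_k, the left-hand side is the excess of the energy at k
    over (1 - x^2) v^2 and the right-hand side what is lost in the next two
    steps, A1 and A2 being the friction coefficients. If e <= 0 both losses
    are needed, and both are at least a multiple of e^2; if e > 0 the first
    one is enough, since t bounds e from above. *)
Lemma two_step (A1 A2 g t v e x : R) : 0 <= A1 -> 0 <= A2 -> 0 <= g -> 0 <= x -> x < 1 ->
  0 <= v -> 0 <= t ->
  1 <= A1 + A2 * (1 + 2 * x * g) ^+ 2 ->
  t ^+ 2 <= A1 * (1 + x + x * t) ^+ 2 ->
  - ((1 - x) * v) <= e <= t * ((1 - x) * v) ->
  e ^+ 2 <= A1 * ((1 - x ^+ 2) * v + x * e) ^+ 2 +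
            A2 * (2 * x * g * ((1 - x ^+ 2) * v + x * e) - e) ^+ 2.
Proof.
move=> A10 A20 g0 x0 x1 v0 t0 c1 c2 /andP[e1 e2].
set w := (1 - x) * v; have w0 : 0 <= w by rewrite mulr_ge0// subr_ge0 ltW.
rewrite -/w in e1 e2.
set Y := _ + x * e.
have YE : Y = w * (1 + x) + x * e by rewrite /Y /w; ring.
(* Here - e <= Y because - e is at most w; for e > 0 only the bound by t
   remains. *)
have [en|ep] := leP e 0.
  have Yw : - e <= Y.
    rewrite YE; have : x * (- w) <= x * e by rewrite ler_wpM2l.
    by nra.
  have Y0 : 0 <= Y by lra.
  apply: (@le_trans _ _ (A1 * (- e) ^+ 2 + A2 * ((1 + 2 * x * g) * (- e)) ^+ 2)).
    by have := ler_wpM2r (sqr_ge0 e) c1; lra.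
  have xg0 : 0 <= 2 * x * g by rewrite !mulr_ge0.
  have xgY : 2 * x * g * (- e) <= 2 * x * g * Y by rewrite ler_wpM2l.
  apply: lerD; rewrite ler_wpM2l//; apply: le_sqr => //; first lra.
    by rewrite mulr_ge0//; lra.
  lra.
rewrite -[X in X <= _]addr0; apply: lerD; last by rewrite mulr_ge0// sqr_ge0.
have tp : 0 < t.
  rewrite lt_neqAle t0 andbT; apply/eqP => tE; move: e2; rewrite -tE mul0r; lra.
rewrite -(ler_pM2l (exprn_gt0 2 tp)).
have tY : e * (1 + x + x * t) <= t * Y.
  rewrite YE; have : e * (1 + x) <= t * w * (1 + x) by rewrite ler_wpM2r//; lra.
  lra.
apply: (@le_trans _ _ (A1 * (e * (1 + x + x * t)) ^+ 2)).
  by have := ler_wpM2l (sqr_ge0 e) c2; lra.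
have -> : t ^+ 2 * (A1 * Y ^+ 2) = A1 * (t * Y) ^+ 2 by ring.
rewrite ler_wpM2l//; apply: le_sqr => //.
by rewrite mulr_ge0// ?addr_ge0 ?mulr_ge0// ltW.
Qed.

End Energy.

(** * Two steps of energy loss after a trough *)

Section Trough.
Variable R : realFieldType.
Implicit Types (l x : R) (u : nat -> R) (n : nat).

Lemma ultra_seq_pred l x u n : ultra_seq l x u -> (0 < n)%N ->
  (n%:R + 2 * l) * u n.+1 = 2 * (n%:R + l) * x * u n - n%:R * u n.-1.
Proof. by move=> [_ _ _ uS]; case: n => // n _; exact: uS. Qed.

(** At a trough the recurrence reads 2 (k + l) (1 - x) u_k =
    k (u_k - u_(k-1)) + (k + 2 l) (u_k - u_(k+1)). *)
Lemma trough_neg l x u k : ultra_seq l x u -> (0 < k)%N -> x < 1 ->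
  u k <= u k.-1 -> u k <= u k.+1 -> u k <= 0.
Proof.
move=> hu k0 x1 hm hp; have := ultra_seq_pred hu k0; case: hu => hl _ _ _ e.
have kp : 0 < k%:R :> R by rewrite ltr0n.
have : 0 <= - (k%:R + l) * (1 - x) * u k by nra.
rewrite mulNr mulNr oppr_ge0 pmulr_rle0// mulr_gt0//; lra.
Qed.

(** The quantity u_(k+1) - x u_k measures the excess of the energy at the
    trough. Its lower bound is u_k <= u_(k+1); its upper bound is u_k <=
    u_(k-1), transported by the recurrence. *)
Lemma trough_defect l x u k : ultra_seq l x u -> (0 < k)%N -> x < 1 ->
  u k <= u k.-1 -> u k <= u k.+1 ->
  - ((1 - x) * - u k) <= u k.+1 - x * u k <=
    k%:R / (k%:R + 2 * l) * ((1 - x) * - u k).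
Proof.
move=> hu k0 x1 hm hp; have := ultra_seq_pred hu k0; case: hu => hl _ _ _ e.
have kp : 0 < k%:R :> R by rewrite ltr0n.
apply/andP; split; first lra.
rewrite mulrAC ler_pdivlMr; last lra.
have : k%:R * u k <= k%:R * u k.-1 by rewrite ler_pM2l.
lra.
Qed.

(** Two applications of the energy balance, the increments being expressed
    through the data at the trough. *)
Lemma two_step_energy l x u k : ultra_seq l x u ->
  let e := u k.+1 - x * u k in
  let Y := (1 - x ^+ 2) * - u k + x * e in
  energy x u k.+2 = (1 - x ^+ 2) * (- u k) ^+ 2 + e ^+ 2
    - 4 * l * (k.+1%:R + l) / (k.+1%:R + 2 * l) ^+ 2 * Y ^+ 2
    - 4 * l * (k.+2%:R + l) / (k.+2%:R + 2 * l) ^+ 2 *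
      (2 * x * ((k.+1%:R + l) / (k.+1%:R + 2 * l)) * Y - e) ^+ 2.
Proof.
move=> hu e Y; rewrite (energyS _ hu) (energyS _ hu).
case: (hu) => hl _ _ uS; have uS1 := uS k; have uS2 := uS k.+1.
have n0 : 0 <= k%:R :> R by [].
have : 0 < k.+1%:R :> R by [].
move: uS1 uS2; rewrite /energy /Y /e -[k.+2%:R]natr1.
move: (k.+1%:R : R) (u k) (u k.+1) (u k.+2) (u k.+3) => a p q r s.
move=> uS1 uS2 a0.
have h1 : a + l != 0 by apply: lt0r_neq0; lra.
have h2 : a + 1 + l != 0 by apply: lt0r_neq0; lra.
have h3 : a + 2 * l != 0 by apply: lt0r_neq0; lra.
have h4 : a + 1 + 2 * l != 0 by apply: lt0r_neq0; lra.
have -> : s = (2 * (a + 1 + l) * x * r - (a + 1) * q) / (a + 1 + 2 * l).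
  by apply: (mulfI h4); rewrite uS2 mulrCA mulfV// mulr1.
have -> : r = (2 * (a + l) * x * q - a * p) / (a + 2 * l).
  by apply: (mulfI h3); rewrite uS1 mulrCA mulfV// mulr1.
by field; rewrite h1 h2 h3 h4.
Qed.

Lemma ultra_diff12 l x u : ultra_seq l x u ->
  (2 * l + 1) * (u 1%N - u 2%N) = (1 - x) * ((2 * l + 2) * x + 1).
Proof. by move=> [_ e0 e1 /(_ 0%N)]; rewrite e0 e1; lra. Qed.

Lemma ultra_diff23 l x u : ultra_seq l x u ->
  (2 * l + 1) * (u 2%N - u 3%N) = (1 - x) * (2 * (l + 2) * x ^+ 2 + 2 * x - 1).
Proof.
move=> hu; have [hl e0 e1 uS] := hu.
have h2 := uS 0%N; have h3 := uS 1%N; rewrite e0 e1 in h2 h3.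
have l2 : 2 + 2 * l != 0 by nz.
apply: (mulfI l2).
transitivity ((2 + 2 * l) * ((1 + 2 * l) * u 2%N) - (1 + 2 * l) * ((2 + 2 * l) * u 3%N)).
  by ring.
rewrite h2 h3.
have -> : (1 + 2 * l) * (2 * (2 + l) * x * u 2%N - 2 * x) =
  2 * (2 + l) * x * ((1 + 2 * l) * u 2%N) - 2 * x * (1 + 2 * l) by ring.
by rewrite h2; ring.
Qed.

(** The two numerical conditions of [two_step], for a trough of index K. The
    index is a real number so that bounds can be used that are monotone in
    it. *)
Definition two_step_ok l x (K : R) : Prop :=
  let A1 := 4 * l * (K + 1 + l) / (K + 1 + 2 * l) ^+ 2 in
  let A2 := 4 * l * (K + 2 + l) / (K + 2 + 2 * l) ^+ 2 in
  let g := (K + 1 + l) / (K + 1 + 2 * l) in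
  let t := K / (K + 2 * l) in
  1 <= A1 + A2 * (1 + 2 * x * g) ^+ 2 /\ t ^+ 2 <= A1 * (1 + x + x * t) ^+ 2.

Lemma trough_two_step l x u k n : ultra_seq l x u -> (0 < k)%N -> 0 <= x < 1 ->
  u k <= u k.-1 -> u k <= u k.+1 ->
  two_step_ok l x k%:R -> (k <= n)%N -> u k <= u n.
Proof.
move=> hu k0 /andP[x0 x1] hm hp []; set A1 := _ / _; set A2 := _ / _.
set g := _ / _; set t := _ / _ => c1 c2 kn.
have uk := trough_neg hu k0 x1 hm hp.
have eb := trough_defect hu k0 x1 hm hp.
have [hl _ _ _] := hu.
have E1 : k.+1%:R = k%:R + 1 :> R by rewrite natr1.
have E2 : k.+2%:R = k%:R + 2 :> R by rewrite -natr1 E1 -addrA.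
have n0 : 0 <= k%:R :> R by [].
have [kn2|] := leqP k.+2 n; last first.
  rewrite ltnS leq_eqVlt => /orP[/eqP->//|]; rewrite ltnS => nk.
  by have -> : n = k by apply/eqP; rewrite eqn_leq nk.
rewrite -[u k]opprK; apply: (energy_tail hu _ _ _ kn2).
- by rewrite oppr_ge0.
- nra.
have v0 : 0 <= - u k by rewrite oppr_ge0.
have := two_step (A1 := A1) (A2 := A2) (g := g) _ _ _ x0 x1 v0 _ c1 c2 eb.
rewrite (two_step_energy _ hu) E1 E2 -/A1 -/A2 -/g => h.
suff : (u k.+1 - x * u k) ^+ 2 <=
    A1 * ((1 - x ^+ 2) * - u k + x * (u k.+1 - x * u k)) ^+ 2 +
    A2 * (2 * x * g * ((1 - x ^+ 2) * - u k + x * (u k.+1 - x * u k)) -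
          (u k.+1 - x * u k)) ^+ 2 by lra.
apply: h.
- by rewrite divr_ge0 ?sqr_ge0// !mulr_ge0//; lra.
- by rewrite divr_ge0 ?sqr_ge0// !mulr_ge0//; lra.
- by rewrite divr_ge0//; lra.
- by rewrite divr_ge0//; lra.
Qed.

(** The differences satisfy, up to scaling, the recurrence of the Jacobi
    polynomials of parameters alpha + 1 and alpha; the symmetric placement of
    the coefficients is what makes Casoratians telescope. *)
Lemma diff_rec l x u n : ultra_seq l x u ->
  (n.+1%:R + 1 + 2 * l) / (n.+1%:R + 1 + l) * (u n.+2 - u n.+3) +
  n.+1%:R / (n.+1%:R + l) * (u n - u n.+1) =
  (2 * x + l / ((n.+1%:R + l) * (n.+1%:R + l + 1))) * (u n.+1 - u n.+2).
Proof.
move=> [hl _ _ uS]; have uS1 := uS n; have uS2 := uS n.+1.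
have : 0 < n.+1%:R :> R by [].
move: uS1 uS2; rewrite -[n.+2%:R]natr1.
move: (n.+1%:R : R) (u n) (u n.+1) (u n.+2) (u n.+3) => a p q r s.
move=> uS1 uS2 a0.
have h1 : a + l != 0 by apply: lt0r_neq0; lra.
have h2 : a + 1 + l != 0 by apply: lt0r_neq0; lra.
have h3 : a + 1 + 2 * l != 0 by apply: lt0r_neq0; lra.
have h4 : a != 0 by apply: lt0r_neq0.
have h5 : a + l + 1 != 0 by apply: lt0r_neq0; lra.
have -> : s = (2 * (a + 1 + l) * x * r - (a + 1) * q) / (a + 1 + 2 * l).
  by apply: (mulfI h3); rewrite uS2 mulrCA mulfV// mulr1.
have -> : p = (2 * (a + l) * x * q - (a + 2 * l) * r) / a.
  by apply: (mulfI h4); rewrite uS1 mulrCA mulfV// mulr1; ring.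
by field; rewrite h1 h3 h4 h5.
Qed.

End Trough.

(** * How far out a trough can lie *)

Section Link.
Variable R : realFieldType.
Implicit Types (l x : R) (u : nat -> R) (n : nat).

(** Up to a constant, the square of y + l + 1/2. *)
Definition tau l (y : R) := y * (y + 2 * l + 1).

(** A nonnegative sequence vanishing to second order at the index where tau
    equals T. The first factor turns the operator of [diff_rec] into a
    polynomial in T - tau. *)
Definition bump l T (y : R) := (y + l + 1 / 2) * (T - tau l y) ^+ 2.

(** The difference of the two sides is a positive multiple of the quadratic
    K - 2 (2 l + 5) z + (1 - x) z^2 in z = T - tau l y, where K is the last
    factor of the hypothesis; the hypothesis says that its discriminant is
    negative. *)
Lemma bump_super l T x (y : R) : 0 < l -> 0 < T -> 0 <= y ->
  (2 * l + 5) ^+ 2 < (1 - x) * (4 * T + 2 * (2 * l + 3) * (l + 1)) ->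
  (2 * x + l / ((y + l) * (y + l + 1))) * bump l T y <
  (y + 1 + 2 * l) / (y + 1 + l) * bump l T (y + 1) +
  y / (y + l) * bump l T (y - 1).
Proof.
move=> l0 T0 y0; set K := 4 * T + _ => big; rewrite -subr_gt0.
have K0 : 0 < K by rewrite /K ltr_pwDr//; [rewrite !mulr_gt0//; lra|rewrite mulr_ge0//; lra].
set z := T - tau l y.
rewrite [X in 0 < X](_ : _ = (2 * y + 2 * l + 1) *
  (K - 2 * (2 * l + 5) * z + (1 - x) * z ^+ 2)); last first.
  by rewrite /z /K /bump /tau; field; nz.
rewrite mulr_gt0//; first lra.
rewrite -(pmulr_rgt0 _ K0).
have := sqr_ge0 ((2 * l + 5) * z - K).
have [->|z0] := eqVneq z 0; first by have := exprn_gt0 2 K0; lra.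
have : 0 < z ^+ 2 * ((1 - x) * K - (2 * l + 5) ^+ 2).
  by rewrite mulr_gt0 ?exprn_even_gt0//; lra.
lra.
Qed.

(** Sturm comparison. If the differences of u are nonnegative up to m, they
    cannot be compared with a strict supersolution vanishing at m: their
    Casoratian with it is negative from the start on, but at m it has the
    sign of the remaining nonnegative term. So [bump_super] must fail, and
    this bounds (1 - x) m^2 in terms of l. *)
Lemma trough_index_le l x u m : ultra_seq l x u -> x < 1 -> (0 < m)%N ->
  (forall n, (n <= m)%N -> u n.+1 <= u n) ->
  (1 - x) * (4 * tau l m%:R + 2 * (2 * l + 3) * (l + 1)) <= (2 * l + 5) ^+ 2.
Proof.
move=> hu x1 m0 dec; rewrite leNgt; apply/negP => big.
have [hl e0 e1 uS] := hu.
set T := tau l m%:R in big.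
have l0 : 0 < l by lra.
have T0 : 0 < T by rewrite mulr_gt0 ?ltr0n//; have : 0 <= m%:R :> R by []; lra.
pose Q n := u n - u n.+1.
pose F (n : nat) : R := bump l T n%:R.
have Q0 n : (n <= m)%N -> 0 <= Q n by move=> /dec; rewrite /Q; lra.
have F0 n : 0 <= F n by rewrite mulr_ge0 ?sqr_ge0//; have : 0 <= n%:R :> R by []; lra.
(* Negativity of V says that Q / F is strictly decreasing. *)
pose V n := F n * Q n.+1 - Q n * F n.+1.
have V_lt n : (n < m)%N -> V n < 0.
  elim: n => [|n ih] nm.
    have s : (2 * x + l / (l * (l + 1))) * F 0%N < (1 + 2 * l) / (1 + l) * F 1%N.
      by have := bump_super l0 T0 (lexx _) big; rewrite mul0r mul0r addr0 !add0r.
    have := uS 0%N; rewrite /V /Q e0 e1.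
    move: (F 0%N) (F 1%N) s => f0 f1 s r.
    have h2 : 0 < (1 + 2 * l) / (1 + l) by rewrite divr_gt0//; lra.
    rewrite -(pmulr_rlt0 _ h2) mulrBr.
    have -> : (1 + 2 * l) / (1 + l) * (f0 * (x - u 2)) =
      (2 * x + l / (l * (l + 1))) * f0 * (1 - x).
      have h3 : 1 + 2 * l != 0 by apply: lt0r_neq0; lra.
      have -> : u 2 = (2 * (1 + l) * x * x - 1) / (1 + 2 * l).
        by apply: (mulfI h3); rewrite r mulrCA mulfV// !mulr1.
      by field; nz.
    have x1' : 0 < 1 - x by lra.
    by rewrite -(ltr_pM2r x1') in s; lra.
  have y0 : 0 <= n.+1%:R :> R by [].
  have h2 : 0 < (n.+1%:R + 1 + 2 * l) / (n.+1%:R + 1 + l) by rewrite divr_gt0//; lra.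
  have h3 : 0 < n.+1%:R / (n.+1%:R + l) by rewrite divr_gt0//; lra.
  have d := diff_rec n hu.
  have := bump_super l0 T0 y0 big; rewrite natr1 -/(F n.+2) -/(F n.+1).
  rewrite -[X in X - 1]natr1 addrK -/(F n).
  have Qn := Q0 n.+1 (ltnW nm).
  have := ih (ltnW nm); rewrite -(pmulr_rlt0 _ h3) => ihn s.
  rewrite -(pmulr_rlt0 _ h2); apply: le_lt_trans ihn.
  move: (ltW s) d h2; rewrite natr1 /V -/(Q n.+2) -/(Q n.+1) -/(Q n) => {}s.
  move: (_ / _) (n.+1%:R / _) (2 * x + _) s => a c B; move/(ler_wpM2l Qn).
  move: (Q n) (Q n.+1) (Q n.+2) (F n) (F n.+1) (F n.+2) => q r t f g h s d _.
  have -> : a * (g * t - r * h) = g * (a * t) - r * (a * h) by ring.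
  have -> : a * t = B * r - c * q by lra.
  lra.
(* At m the supersolution vanishes, so V (m - 1) = F (m - 1) * Q m. *)
have := V_lt m.-1; rewrite prednK// leqnn /V prednK// => /(_ isT).
rewrite {2}/F /bump subrr expr0n mulr0 mulr0 subr0.
by apply/negP; rewrite -leNgt mulr_ge0// Q0.
Qed.

End Link.

(** * The energy at a sign change *)

Section Crossing.
Variable R : realFieldType.
Implicit Types (l x : R) (u : nat -> R) (n : nat).

(** A weighted form of the energy balance, in which the right-hand side
    involves the middle term alone. *)
Lemma energy_exchange l x u n : ultra_seq l x u ->
  (n.+1%:R + 2 * l) ^+ 2 * energy x u n.+1 - n.+1%:R ^+ 2 * energy x u n =
  4 * l * (n.+1%:R + l) * ((1 - x ^+ 2) * u n.+1 ^+ 2).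
Proof.
move=> [hl _ _ /(_ n)]; rewrite /energy.
have n0 : 0 < n.+1%:R :> R by [].
move: (n.+1%:R) n0 (u n) (u n.+1) (u n.+2) => a a0 p q r h.
have h1 : a + 2 * l != 0 by apply: lt0r_neq0; lra.
have -> : r = (2 * (a + l) * x * q - a * p) / (a + 2 * l).
  by apply: (mulfI h1); rewrite h mulrCA mulfV// mulr1.
by field; nz.
Qed.

(** If u vanished at N the energy would drop there by the factor
    (N / (N + 2 l))^2, by [energy_exchange]. When the sign changes between
    two indices the two losses around it still add up to one such factor. *)
Lemma crossing_energy l x u n : ultra_seq l x u -> 0 <= x <= 1 ->
  u n.+1 <= 0 -> 0 <= u n.+2 ->
  (n.+2%:R + 2 * l) ^+ 2 * energy x u n.+2 <= n.+2%:R ^+ 2 * energy x u n.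
Proof.
move=> hu /andP[x0 x1] un up.
have i1 := energy_exchange n hu; have i2 := energy_exchange n.+1 hu.
have [hl _ _ _] := hu.
set E := energy x u n.+1 in i1 i2.
have Eu : u n.+1 ^+ 2 + u n.+2 ^+ 2 <= E.
  rewrite /E /energy; have : 0 <= x * (- u n.+1 * u n.+2) by rewrite !mulr_ge0//; lra.
  lra.
have Es : (1 - x ^+ 2) * u n.+2 ^+ 2 <= E - (1 - x ^+ 2) * u n.+1 ^+ 2.
  have := sqr_ge0 (u n.+1); have := sqr_ge0 (u n.+2); have := sqr_ge0 x; nra.
have E1 : 0 <= E - (1 - x ^+ 2) * u n.+1 ^+ 2.
  by apply: le_trans Es; rewrite mulr_ge0 ?sqr_ge0// subr_ge0 expr_le1.
have a0 : 0 < n.+1%:R :> R by [].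
move: i1 i2 Es E1; rewrite -[n.+2%:R]natr1.
move: (n.+1%:R) a0 (energy x u n) (energy x u n.+2) ((1 - x ^+ 2) * u n.+1 ^+ 2)
  ((1 - x ^+ 2) * u n.+2 ^+ 2) => a a0 F G p q i1 i2 Es E1.
have -> : (a + 1 + 2 * l) ^+ 2 * G = (a + 1) ^+ 2 * E + 4 * l * (a + 1 + l) * q by lra.
have -> : F = E + 4 * l * (a + l) / a ^+ 2 * (E - p).
  apply: (@mulfI _ (a ^+ 2)); first by rewrite expf_neq0// lt0r_neq0.
  have -> : a ^+ 2 * F = (a + 2 * l) ^+ 2 * E - 4 * l * (a + l) * p by lra.
  by field; nz.
rewrite [X in _ <= X]mulrDr lerD2l.
apply: (@le_trans _ _ (4 * l * (a + 1 + l) * (E - p))).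
  by rewrite ler_wpM2l// !mulr_ge0//; lra.
rewrite mulrA ler_wpM2r// mulrA ler_pdivlMr ?exprn_gt0//.
have : 0 <= l * (a ^+ 2 + 2 * (a * l) + a + l).
  by rewrite mulr_ge0 ?addr_ge0 ?mulr_ge0 ?sqr_ge0//; lra.
lra.
Qed.

(** Below zero the restoring force pushes u up, so a sequence that rises goes
    on rising as long as it is negative. *)
Lemma rise_step l x u n : ultra_seq l x u -> x <= 1 -> u n.+1 <= 0 ->
  u n <= u n.+1 -> u n.+1 <= u n.+2.
Proof.
move=> [hl _ _ uS] x1 un d; have := uS n.
have a0 : 0 < n.+1%:R :> R by [].
move: (n.+1%:R) a0 (u n) (u n.+1) (u n.+2) un d => a a0 p q r un d h.
have : 0 <= (a + 2 * l) * (r - q).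
  have -> : (a + 2 * l) * (r - q) = a * (q - p) + 2 * (a + l) * ((1 - x) * - q) by lra.
  by rewrite addr_ge0// ?mulr_ge0//; lra.
by rewrite pmulr_rge0; lra.
Qed.

Lemma rise_while_neg l x u k n : ultra_seq l x u -> x <= 1 -> u k <= 0 -> u k <= u k.+1 ->
  (k <= n)%N -> (forall i, (k < i <= n)%N -> u i <= 0) ->
  u n <= u n.+1 /\ u k <= u n.
Proof.
move=> hu x1 uk d /subnK <-; elim: (n - k)%N => [|j ih] h; first by rewrite add0n.
have [|a b] := ih.
  by move=> i /andP[ki ij]; apply: h; rewrite ki (leq_trans ij)// leq_add2r.
rewrite addSn in h *.
have un : u (j + k).+1 <= 0 by apply: h; rewrite ltnS leq_addl leqnn.
by split; [exact: rise_step hu x1 un a|exact: le_trans a].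
Qed.

(** Up to the first nonnegative term after the trough u increases, hence
    stays above u_k. From there on the energy is used: at k, or one step
    before k if the sign change is immediate, it is at most 2 (1 - x) u_k^2,
    and the sign change at N multiplies it by (N / (N + 2 l))^2. The
    hypothesis on N says that the product is at most (1 - x^2) u_k^2. *)
Lemma crossing_trough l x u k n : ultra_seq l x u -> (0 < k)%N -> 0 <= x < 1 ->
  u k <= u k.-1 -> u k <= u k.+1 ->
  (forall N : nat, (k < N)%N -> (forall i, (k < i < N)%N -> u i < 0) ->
     2 * N%:R ^+ 2 <= (1 + x) * (N%:R + 2 * l) ^+ 2) ->
  (k <= n)%N -> u k <= u n.
Proof.
move=> hu k0 /andP[x0 x1] hm hp bnd kn.
have uk := trough_neg hu k0 x1 hm hp.
have eb := trough_defect hu k0 x1 hm hp.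
have [hl _ _ _] := hu.
have [/existsP[N0 /andP[kN0 uN0]]|nopos] := boolP [exists i : 'I_n.+1,
  (k < i)%N && (0 <= u i)]; last first.
  apply: (rise_while_neg hu (ltW x1) uk hp kn _).2 => i /andP[ki ni].
  rewrite leNgt; apply/negP => ui; move/negP: nopos; apply.
  by apply/existsP; exists (Ordinal (ni : (i < n.+1)%N)); rewrite /= ki ltW.
have ex : exists i, (k < i)%N && (0 <= u i) by exists N0; rewrite kN0.
case: (ex_minnP ex) => N /andP[kN uN] Nmin.
have neg i : (k < i < N)%N -> u i < 0.
  by move=> /andP[ki iN]; rewrite ltNge; apply/negP => ui; have := Nmin i;
    rewrite ki ui leqNgt iN => /(_ isT).
have [nN|Nn] := ltnP n N.
  apply: (rise_while_neg hu (ltW x1) uk hp kn _).2 => i /andP[ki ni].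
  by rewrite ltW// neg// ki (leq_ltn_trans ni).
have {}bnd := bnd N kN neg.
have uN1 : u N.-1 <= 0.
  move: kN; rewrite -ltnS; case: (N) neg => // M neg;
    rewrite /= !ltnS leq_eqVlt => /orP[/eqP<-//|kM].
  by rewrite ltW// neg// kM /=.
rewrite -[u k]opprK; apply: (energy_tail hu _ _ _ Nn).
- by rewrite oppr_ge0.
- nra.
case: N kN uN {Nmin neg Nn} bnd uN1 => [//|[|m]] kN uN bnd uN1.
  by move: kN; rewrite ltnS leqn0 => /eqP k00; rewrite k00 in k0.
have cE : energy x u m.+2 * (m.+2%:R + 2 * l) ^+ 2 <= m.+2%:R ^+ 2 * energy x u m.
  by rewrite mulrC; apply: crossing_energy => //; rewrite x0 ltW.
have v0 : 0 <= - u k by rewrite oppr_ge0.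
(* The sign change is between m + 1 and m + 2; if k = m + 1 the energy is
   taken one step before the trough, where it has the same bound. *)
have Em : energy x u m <= 2 * (1 - x) * (- u k) ^+ 2.
  move: kN; rewrite ltnS leq_eqVlt => /orP[/eqP kE|km].
    move: hm hp uN uN1 eb v0 bnd cE; rewrite kE /= => hm hp uN uN1 eb v0 bnd cE.
    have w0 : 0 <= (1 - x) * - u m.+1 by rewrite mulr_ge0//; lra.
    have le0 : u m - x * u m.+1 <= 0.
      have a0 : 0 < m.+1%:R :> R by [].
      rewrite -(pmulr_rle0 _ a0).
      have -> : m.+1%:R * (u m - x * u m.+1) = - ((m.+1%:R + 2 * l) * (u m.+2 - x * u m.+1)).
        by have [_ _ _ /(_ m)] := hu; lra.
      rewrite oppr_le0 mulr_ge0//; first lra.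
      have : 0 <= x * - u m.+1 by rewrite mulr_ge0.
      lra.
    have : (- (u m - x * u m.+1)) ^+ 2 <= ((1 - x) * - u m.+1) ^+ 2 by apply: le_sqr; lra.
    by rewrite /energy; lra.
  apply: (@le_trans _ _ (energy x u k)); first by apply: (energy_le hu); rewrite -ltnS.
  have w0 : 0 <= (1 - x) * - u k by rewrite mulr_ge0//; lra.
  have kp : 0 < k%:R :> R by rewrite ltr0n.
  have tw : k%:R / (k%:R + 2 * l) * ((1 - x) * - u k) <= (1 - x) * - u k.
    by rewrite -[X in _ <= X]mul1r ler_wpM2r// ler_pdivrMr; lra.
  have : (u k.+1 - x * u k) ^+ 2 <= ((1 - x) * - u k) ^+ 2.
    case/andP: eb => eb1 eb2; have [en|ep] := leP (u k.+1 - x * u k) 0.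
      by rewrite -sqrrN; apply: le_sqr; lra.
    by apply: le_sqr; lra.
  by rewrite /energy; lra.
have e2 : 2 * m.+2%:R ^+ 2 * energy x u m <=
   (1 - x ^+ 2) * (- u k) ^+ 2 * (2 * (m.+2%:R + 2 * l) ^+ 2).
  have M0 : 0 <= 2 * m.+2%:R ^+ 2 :> R by rewrite mulr_ge0// sqr_ge0.
  apply: le_trans (ler_wpM2l M0 Em) _.
  have w0 : 0 <= 2 * (1 - x) * (- u k) ^+ 2 by rewrite !mulr_ge0 ?sqr_ge0//; lra.
  by have := ler_wpM2r w0 bnd; lra.
have p : 0 < (m.+2%:R + 2 * l) ^+ 2 by rewrite exprn_gt0// addr_gt0//; lra.
by rewrite -(ler_pM2r p); lra.
Qed.

End Crossing.

(** * A sign change must come soon *)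

Section Crossing.
Variable R : realFieldType.
Implicit Types (l x : R) (u : nat -> R) (n : nat).

(** On a rising negative stretch of length 2 L let A be the absolute value of
    the middle term. On the first half every increment gains about (1 - x) A
    per step, friction being weak because m is large compared with l L; on
    the second half the speed acquired is lost only slowly. The total rise
    over the second half is then at least (2/3) (1 - x) L^2 A >= A,
    contradicting negativity. *)
Lemma crossing_before l x u m L : ultra_seq l x u -> x <= 1 -> (0 < L)%N ->
  u m <= u m.+1 -> 4 * l * L%:R <= m%:R -> 3 <= 2 * (1 - x) * L%:R ^+ 2 ->
  ~ (forall j, (0 < j <= 2 * L)%N -> u (m + j)%N < 0).
Proof.
move=> hu x1 L0 d0 mL etaL neg.
have [hl _ _ uS] := hu.
have LR : 0 < L%:R :> R by rewrite ltr0n.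
pose D j := u (m + j).+1 - u (m + j)%N.
have Drec j : (0 < j)%N -> ((m + j)%:R + 2 * l) * D j =
    (m + j)%:R * D j.-1 + 2 * ((m + j)%:R + l) * (1 - x) * - u (m + j)%N.
  by case: j => // j _; rewrite /D addnS /=; have := uS (m + j)%N; lra.
have Dge0 j : (j <= 2 * L)%N -> 0 <= D j.
  elim: j => [|j ih] jL; first by rewrite /D addn0 subr_ge0.
  have h : 0 < (m + j.+1)%:R + 2 * l by have : 0 <= (m + j.+1)%:R :> R by []; lra.
  rewrite -(pmulr_rge0 _ h) Drec// addr_ge0//; first by rewrite mulr_ge0// ih// ltnW.
  rewrite mulr_ge0//; last by rewrite oppr_ge0 ltW// neg.
  by rewrite !mulr_ge0//; [have : 0 <= (m + j.+1)%:R :> R by []|]; lra.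
have mono i j : (i <= j <= 2 * L)%N -> u (m + i)%N <= u (m + j)%N.
  move=> /andP[/subnK <-]; elim: (j - i)%N => // k ih kL.
  apply: le_trans (ih _) _; first by rewrite ltnW.
  by have := Dge0 (k + i)%N (ltnW kL); rewrite /D subr_ge0 -addnS.
set A := - u (m + L)%N.
have L2 : (L <= 2 * L)%N by rewrite leq_pmull.
have A0 : 0 < A by rewrite oppr_gt0 neg// L0.
have w0 : 0 <= (1 - x) * A by rewrite mulr_ge0//; lra.
(* First half: the increments grow at least linearly. The factor 4/3, out of
   a possible 2, leaves room for the friction. *)
have step1 j : (j <= L)%N -> 4 / 3 * j%:R * ((1 - x) * A) <= D j.
  elim: j => [|j ih] jL; first by rewrite mulr0 mul0r Dge0.
  have n0 : 0 <= m%:R :> R by [].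
  have j0 : 0 <= j%:R :> R by [].
  have h : 0 < (m + j.+1)%:R + 2 * l by have : 0 <= (m + j.+1)%:R :> R by []; lra.
  rewrite -(ler_pM2l h) Drec//=.
  have {}ih := ih (ltnW jL).
  have Aj : (1 - x) * A <= (1 - x) * - u (m + j.+1)%N.
    by rewrite ler_wpM2l//; [lra|rewrite lerN2 mono// jL].
  have mL' : m%:R <= (m + j.+1)%:R :> R by rewrite ler_nat leq_addr.
  have jl : l * j.+1%:R <= l * L%:R by rewrite ler_wpM2l ?ler_nat//; lra.
  apply: (@le_trans _ _ ((m + j.+1)%:R * (4 / 3 * j%:R * ((1 - x) * A)) +
     2 * ((m + j.+1)%:R + l) * ((1 - x) * A))); last first.
    apply: lerD; first by rewrite ler_wpM2l.
    by rewrite -[X in _ <= X]mulrA ler_wpM2l// mulr_ge0//; lra.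
  set M := (m + j.+1)%:R; set W := (1 - x) * A in w0 *.
  have Mm : 4 * l * j.+1%:R <= M.
    by apply: le_trans (le_trans _ mL) mL'; lra.
  have : 0 <= (2 / 3 * M + 2 * l - 8 / 3 * (l * j.+1%:R)) * W by rewrite mulr_ge0//; lra.
  by rewrite -natr1; lra.
(* Second half: no gain is used, friction alone reduces the increments. *)
have step2 j : (j <= L)%N -> (2 * L%:R - j%:R) * (2 / 3 * ((1 - x) * A)) <= D (L + j)%N.
  elim: j => [|j ih] jL; first by rewrite addn0 subr0; have := step1 L (leqnn _); lra.
  have {}ih := ih (ltnW jL).
  have jL2 : (L + j.+1 <= 2 * L)%N by rewrite mul2n -addnn leq_add2l.
  have h : 0 < (m + (L + j.+1))%:R + 2 * l by have : 0 <= (m + (L + j.+1))%:R :> R by []; lra.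
  rewrite -(ler_pM2l h) Drec ?addnS//= -addnS.
  apply: (@le_trans _ _ ((m + (L + j).+1)%:R * D (L + j)%N)); last first.
    rewrite lerDl mulr_ge0//; last by rewrite oppr_ge0 ltW// neg// -addnS jL2 addnS.
    by rewrite !mulr_ge0//; [have : 0 <= (m + (L + j).+1)%:R :> R by []|]; lra.
  apply: le_trans (ler_wpM2l _ ih) => //.
  set M := (m + (L + j).+1)%:R; set W := (1 - x) * A in w0 *.
  have Mm : 4 * l * L%:R <= M by apply: le_trans mL _; rewrite ler_nat leq_addr.
  have lj : 0 <= l * j.+1%:R by rewrite mulr_ge0//; lra.
  have : 0 <= (M - 4 * l * L%:R + 2 * (l * j.+1%:R)) * W by rewrite mulr_ge0//; lra.
  by rewrite -[j.+1%:R]natr1; lra.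
(* Each of the L increments is at least (2/3) L (1 - x) A. *)
have step3 j : (j <= L)%N -> - A + j%:R * (2 / 3 * L%:R * ((1 - x) * A)) <= u (m + (L + j))%N.
  elim: j => [|j ih] jL; first by rewrite mul0r addr0 addn0 opprK.
  have {}ih := ih (ltnW jL).
  have := step2 j (ltnW jL); rewrite /D addnS.
  have jl : (2 / 3 * ((1 - x) * A)) * j%:R <= (2 / 3 * ((1 - x) * A)) * L%:R.
    rewrite ler_wpM2l ?ler_nat; [by []|by rewrite mulr_ge0//; lra|exact: ltnW].
  by rewrite -[j.+1%:R]natr1 addnS; lra.
have LL : (L + L = 2 * L)%N by rewrite mul2n addnn.
have := step3 L (leqnn _); rewrite LL => s3.
have u2 : u (m + 2 * L)%N < 0 by apply: neg; rewrite leqnn andbT muln_gt0 L0.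
have : 0 <= (2 * (1 - x) * L%:R ^+ 2 - 3) * A by rewrite mulr_ge0//; lra.
lra.
Qed.

End Crossing.

(** * Troughs for arguments near 1 *)

Section NearOne.
Variable R : archiRealFieldType.
Implicit Types (l x : R) (u : nat -> R) (n : nat).

Lemma least_nat (P : nat -> bool) : (exists n, P n) ->
  exists2 n, P n & forall m, (m < n)%N -> ~~ P m.
Proof.
move=> ex; case: (ex_minnP ex) => n Pn nmin; exists n => // m.
by rewrite ltnNge; apply: contra => /nmin.
Qed.

(** Let e = 1 - x, and take L and Q least such that [crossing_before] applies
    to stretches of length 2 L starting at Q or later. The first sign change
    N after k then satisfies N <= max k Q + 2 L. The condition on N required
    by [crossing_trough] follows from N e <= 4 l (2 - e), and this is checked
    from L e <= 3/4 and, when k is the larger one, from the bound on the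
    index of the trough. *)
Lemma trough_near_one l x u k n : ultra_seq l x u -> (1 < k)%N -> 4 / 5 <= x < 1 ->
  (forall i, (i < k)%N -> u i.+1 <= u i) -> u k <= u k.+1 ->
  (k <= n)%N -> u k <= u n.
Proof.
move=> hu k1 /andP[x4 x1] dec hp.
have k0 : (0 < k)%N by exact: ltnW.
have hm : u k <= u k.-1 by have := dec k.-1; rewrite prednK// leqnn => /(_ isT).
have uk := trough_neg hu k0 x1 hm hp.
have [hl _ _ _] := hu.
apply: (crossing_trough hu k0) => //; first by rewrite x1 andbT; lra.
move=> N kN neg.
set e := 1 - x; have e0 : 0 < e by rewrite /e; lra.
have e5 : e <= 1 / 5 by rewrite /e; lra.
have [L LP Lmin] : exists2 L, 3 <= 2 * e * L%:R ^+ 2 & forall m, (m < L)%N ->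
  ~~ (3 <= 2 * e * m%:R ^+ 2).
  apply: least_nat.
  have b0 : 0 <= 3 / (2 * e) by rewrite divr_ge0// mulr_ge0// ltW.
  exists (Num.bound (3 / (2 * e))).+1.
  have := archi_boundP b0; set B := Num.bound _.
  rewrite ltr_pdivrMr ?mulr_gt0// -natr1 => hB.
  have B0 : 0 <= B%:R :> R by [].
  have : 0 <= 2 * e * (B%:R ^+ 2 + B%:R + 1) by rewrite mulr_ge0 ?addr_ge0 ?mulr_ge0
    ?sqr_ge0//; lra.
  lra.
have L0 : (0 < L)%N by case: (L) LP => //; rewrite expr0n mulr0; lra.
have [Q QP Qmin] : exists2 Q, 4 * l * L%:R <= Q%:R & forall m, (m < Q)%N ->
  ~~ (4 * l * L%:R <= m%:R).
  apply: least_nat; exists (Num.bound (4 * l * L%:R)).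
  by apply/ltW/archi_boundP; rewrite !mulr_ge0//; lra.
have Nbound : (N <= maxn k Q + 2 * L)%N.
  rewrite leqNgt; apply/negP => Nbig; have km : (k <= maxn k Q)%N by exact: leq_maxl.
  apply: (crossing_before hu (ltW x1) L0 (m := maxn k Q)) => //.
  - have mN : (maxn k Q < N)%N by rewrite (leq_ltn_trans _ Nbig)// leq_addr.
    apply: (rise_while_neg hu (ltW x1) uk hp km _).1 => i /andP[ki im].
    by rewrite ltW// neg// ki (leq_ltn_trans im).
  - by apply: le_trans QP _; rewrite ler_nat leq_maxr.
  - move=> j /andP[j0 jL]; apply: neg; apply/andP; split.
      by apply: leq_ltn_trans km _; rewrite -{1}[maxn k Q]addn0 ltn_add2l.
    by apply: leq_ltn_trans Nbig; rewrite leq_add2l.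
(* By minimality of L, (e (L - 1))^2 < 3 e / 2 <= 3/10 < (11/20)^2. *)
have Le : e * L%:R <= 3 / 4.
  have := Lmin L.-1; rewrite prednK// leqnn -ltNge => /(_ isT).
  have -> : L%:R = L.-1%:R + 1 :> R by rewrite natr1 prednK.
  set M := L.-1%:R => hM.
  have : e * M <= 11 / 20.
    apply: le_of_sqr; first lra.
    have : e * (2 * e * M ^+ 2) <= e * 3 by rewrite ler_wpM2l// ltW.
    lra.
  lra.
have Ne : N%:R * e <= 4 * l * (2 - e).
  have [kQ|Qk] := leqP k Q.
    have Q1 : Q%:R <= 4 * l * L%:R + 1.
      have := Qmin Q.-1; have := leq_trans k0 kQ; case: (Q) => // q _ /(_ (leqnn _)).
      by rewrite -ltNge -natr1 /=; lra.
    have NR : N%:R <= Q%:R + 2 * L%:R :> R.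
      by rewrite -natrM -natrD ler_nat; move: Nbound; rewrite (maxn_idPr kQ).
    have : N%:R * e <= (4 * l * L%:R + 1 + 2 * L%:R) * e by rewrite ler_wpM2r ?(ltW e0)//; lra.
    have : (4 * l + 2) * (e * L%:R) <= (4 * l + 2) * (3 / 4) by rewrite ler_wpM2l//; lra.
    have : l * e <= l * (1 / 5) by rewrite ler_wpM2l//; lra.
    lra.
  have NR : N%:R <= k%:R + 2 * L%:R :> R.
    by rewrite -natrM -natrD ler_nat; move: Nbound; rewrite (maxn_idPl (ltnW Qk)).
  have lk : e * (4 * tau l k.-1%:R + 2 * (2 * l + 3) * (l + 1)) <= (2 * l + 5) ^+ 2.
    apply: (trough_index_le hu x1); first by rewrite -ltnS prednK.
    by move=> i ik; apply: dec; rewrite -(prednK k0) ltnS.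
  have kE : k.-1%:R = k%:R - 1 :> R by rewrite -[in RHS](prednK k0) -natr1 addrK.
  rewrite kE /tau in lk.
  (* The bound on the index of the trough, multiplied by e <= 1/5 < (9/20)^2. *)
  have ek : e * (2 * k%:R + 2 * l - 1) <= 9 / 20 * (2 * l + 5).
    apply: le_of_sqr; first lra.
    have h0 : 0 <= e * (6 * l + 5) by rewrite mulr_ge0//; lra.
    have : e * (e * (2 * k%:R + 2 * l - 1) ^+ 2) <= e * (2 * l + 5) ^+ 2 by
      rewrite ler_wpM2l ?(ltW e0)//; lra.
    have : e * (2 * l + 5) ^+ 2 <= 1 / 5 * (2 * l + 5) ^+ 2 by rewrite ler_wpM2r ?sqr_ge0.
    have := sqr_ge0 (2 * l + 5); lra.
  have : N%:R * e <= (k%:R + 2 * L%:R) * e by rewrite ler_wpM2r ?(ltW e0)//; lra.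
  have : l * e <= l * (1 / 5) by rewrite ler_wpM2l//; lra.
  have : 0 <= e * (2 * l - 1) by rewrite mulr_ge0//; lra.
  lra.
have N0 : 0 <= N%:R :> R by [].
have : 0 <= N%:R * (4 * l * (2 - e) - N%:R * e) by rewrite mulr_ge0//; lra.
have : 0 <= (2 - e) * l ^+ 2 by rewrite mulr_ge0 ?sqr_ge0//; lra.
by rewrite /e; lra.
Qed.

End NearOne.

(** * Troughs of index at least 3 for moderate arguments *)

Section Far.
Variable R : realFieldType.
Implicit Types (l x : R) (u : nat -> R) (n : nat).

(** The coefficient is 1 - (b / (b + 2 l))^2; it is one half when
    (b + 2 l) / b reaches the square root of 2. *)
Lemma loss_ge_half l (b : R) : 0 < l -> 0 < b -> 2 * b ^+ 2 <= (b + 2 * l) ^+ 2 ->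
  1 / 2 <= 4 * l * (b + l) / (b + 2 * l) ^+ 2.
Proof. by move=> l0 b0 h; rewrite ler_pdivlMr ?exprn_gt0 ?addr_gt0 ?mulr_gt0//; lra. Qed.

Lemma loss_ge l (b : R) : 1 / 2 <= l -> 0 < b ->
  1 - (b / (b + 1)) ^+ 2 <= 4 * l * (b + l) / (b + 2 * l) ^+ 2.
Proof.
move=> hl b0.
have -> : 4 * l * (b + l) / (b + 2 * l) ^+ 2 = 1 - (b / (b + 2 * l)) ^+ 2.
  by field; nz.
rewrite lerB// le_sqr//; first by rewrite divr_ge0//; lra.
by rewrite ler_pM2l// lef_pV2 ?posrE; lra.
Qed.

(** When l is at least a fixed multiple of K, each of the two loss
    coefficients is at least one half, and nothing about x is needed. *)
Lemma two_step_ok_large l x (K : R) : 1 / 2 <= l -> 0 <= x -> 1 <= K ->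
  2 * (K + 2) ^+ 2 <= (K + 2 + 2 * l) ^+ 2 ->
  two_step_ok l x K.
Proof.
move=> hl x0 K1 h; rewrite /two_step_ok.
set A1 := _ / _; set A2 := _ / _; set g := _ / _; set t := _ / _.
have h1 : 2 * (K + 1) ^+ 2 <= (K + 1 + 2 * l) ^+ 2.
  have : (K + 2) ^+ 2 <= 4 * l * (K + 2) + 4 * l ^+ 2 by lra.
  have : 0 <= l * (K + 2 - 2 * l) \/ K + 2 < 2 * l by case: (leP (2 * l) (K + 2));
    [left; rewrite mulr_ge0//; lra|right].
  nra.
have A1h : 1 / 2 <= A1 by apply: loss_ge_half => //; lra.
have A2h : 1 / 2 <= A2 by apply: loss_ge_half => //; lra.
have g0 : 0 <= g by rewrite divr_ge0//; lra.
have t0 : 0 <= t by rewrite divr_ge0//; lra.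
have th : t ^+ 2 <= 1 / 2.
  rewrite expr_div_n ler_pdivrMr ?exprn_gt0//; last lra.
  nra.
have one_sqr (y : R) : 0 <= y -> 1 <= (1 + y) ^+ 2 by move=> y0; have := sqr_ge0 y; lra.
clearbody A1 A2 g t; split.
  have : 1 / 2 * 1 <= A2 * (1 + 2 * x * g) ^+ 2.
    apply: ler_pM; [lra|lra|exact: A2h|].
    by apply: one_sqr; rewrite !mulr_ge0.
  lra.
apply: le_trans th _; rewrite -[1 / 2]mulr1 -addrA.
apply: ler_pM; [lra|lra|exact: A1h|].
by apply: one_sqr; rewrite addr_ge0// mulr_ge0.
Qed.

(** All quantities in the two conditions are monotone in l and x, so they may
    be replaced by their values at the ends of the ranges: l = 1/2 in the
    losses and in K / (K + 2 l), l = lm and x = c elsewhere. The rational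
    values r1, r2, gm, tm of the resulting quotients are parameters, tied to
    K by equations without division, so that instances are settled by linear
    arithmetic. *)
Lemma two_step_ok_small l x (K lm c r1 r2 gm tm : R) : 1 / 2 <= l <= lm -> 0 <= c <= x ->
  1 <= K -> K + 1 = r1 * (K + 1 + 1) -> K + 2 = r2 * (K + 2 + 1) ->
  K + 1 + lm = gm * (K + 1 + 2 * lm) -> K = tm * (K + 1) ->
  1 <= 1 - r1 ^+ 2 + (1 - r2 ^+ 2) * (1 + 2 * c * gm) ^+ 2 ->
  tm ^+ 2 <= (1 - r1 ^+ 2) * (1 + c + c * tm) ^+ 2 ->
  two_step_ok l x K.
Proof.
move=> /andP[hl llm] /andP[c0 cx] K1 e1 e2 e3 e4.
have <- : (K + 1) / (K + 1 + 1) = r1 by apply: (canLR (mulfK _) e1); nz.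
have <- : (K + 2) / (K + 2 + 1) = r2 by apply: (canLR (mulfK _) e2); nz.
have <- : (K + 1 + lm) / (K + 1 + 2 * lm) = gm by apply: (canLR (mulfK _) e3); nz.
have <- : K / (K + 1) = tm by apply: (canLR (mulfK _) e4); nz.
move=> {e1 e2 e3 e4}.
set a1 := 1 - ((K + 1) / _) ^+ 2; set a2 := 1 - ((K + 2) / _) ^+ 2.
set gm' := (K + 1 + lm) / _; set tm' := K / (K + 1) => h1 h2; rewrite /two_step_ok.
set A1 := _ / _; set A2 := _ / _; set g := _ / _; set t := _ / _.
have K10 : 0 < K + 1 by lra.
have a1A : a1 <= A1 by apply: loss_ge.
have a2A : a2 <= A2 by apply: loss_ge => //; lra.
have ge0 (y : R) : 0 <= y -> 0 <= 1 - (y / (y + 1)) ^+ 2.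
  move=> y0; rewrite subr_ge0 expr_le1//; first by rewrite ler_pdivrMr; lra.
  by rewrite divr_ge0//; lra.
have a10 : 0 <= a1 by apply: ge0; lra.
have a20 : 0 <= a2 by apply: ge0; lra.
have gm0 : 0 <= gm' by rewrite divr_ge0//; lra.
have gmg : gm' <= g.
  by rewrite /gm' /g ler_pdivrMr; [rewrite mulrAC ler_pdivlMr; [nra|lra]|lra].
have t0 : 0 <= t by rewrite divr_ge0//; lra.
have tm0 : 0 <= tm' by rewrite divr_ge0//; lra.
have ttm : t <= tm' by rewrite /t /tm' ler_pM2l ?lef_pV2 ?posrE; lra.
have x0 : 0 <= x by lra.
clearbody a1 a2 gm' tm' A1 A2 g t; split.
  apply: le_trans h1 _; apply: lerD => //; apply: ler_pM; rewrite ?sqr_ge0//.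
  apply: le_sqr; first by rewrite addr_ge0// !mulr_ge0.
  by rewrite lerD2l; apply: ler_pM => //; rewrite ?mulr_ge0//; lra.
have h3 : tm' ^+ 2 <= A1 * (1 + x + x * tm') ^+ 2.
  apply: le_trans h2 _; apply: ler_pM; rewrite ?sqr_ge0//.
  apply: le_sqr; first by rewrite !addr_ge0// mulr_ge0.
  by rewrite lerD// ?ler_wpM2r//; lra.
have p : 0 < (1 + x + x * tm') ^+ 2 by rewrite exprn_gt0// ltr_pwDl ?mulr_ge0//; lra.
rewrite -(ler_pM2r p).
apply: (@le_trans _ _ (tm' ^+ 2 * (1 + x + x * t) ^+ 2)).
  rewrite -!exprMn; apply: le_sqr; first by rewrite mulr_ge0// !addr_ge0// mulr_ge0.
  have : t * (1 + x) <= tm' * (1 + x) by rewrite ler_wpM2r//; lra.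
  lra.
have := ler_wpM2r (sqr_ge0 (1 + x + x * t)) h3.
by rewrite [X in _ <= X -> _]mulrAC.
Qed.

(** If the losses are not large outright then l <= (29/140) (k + 2), and the
    bound on the index of a trough, with 1 - x >= 1/5, leaves 3 <= k <= 8.
    For each of these k the same bound gives a lower bound for x, which is
    what [two_step_ok_small] needs; for k = 3 the inequality u_3 <= u_2 gives
    a better one. *)
Lemma trough_far l x u k n : ultra_seq l x u -> (2 < k)%N -> 0 <= x < 4 / 5 ->
  (forall i, (i < k)%N -> u i.+1 <= u i) -> u k <= u k.+1 ->
  (k <= n)%N -> u k <= u n.
Proof.
move=> hu k2 /andP[x0 x4] dec hp.
have k0 : (0 < k)%N by exact: leq_trans k2.
have hm : u k <= u k.-1 by have := dec k.-1; rewrite prednK// leqnn => /(_ isT).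
have x1 : x < 1 by lra.
have [hl _ _ _] := hu.
have lk : (1 - x) * (4 * tau l k.-1%:R + 2 * (2 * l + 3) * (l + 1)) <= (2 * l + 5) ^+ 2.
  apply: (trough_index_le hu x1); first by rewrite -ltnS prednK// ltnW.
  by move=> i ik; apply: dec; rewrite -(prednK k0) ltnS.
have kE : k.-1%:R = k%:R - 1 :> R by rewrite -[in RHS](prednK k0) -natr1 addrK.
rewrite {}kE /tau in lk.
have K3 : 3 <= k%:R :> R by rewrite (ler_nat R 3).
have q2 : 0 <= 2 * (l + 2) * x ^+ 2 + 2 * x - 1.
  have x1' : 0 < 1 - x by lra.
  by rewrite -(pmulr_rge0 _ x1') -(ultra_diff23 hu) mulr_ge0 ?subr_ge0 ?dec//; lra.
suff ok : two_step_ok l x k%:R by apply: (trough_two_step hu k0); rewrite ?x0.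
set K : R := k%:R; have [P|nP] := leP (2 * (K + 2) ^+ 2) ((K + 2 + 2 * l) ^+ 2).
  by apply: two_step_ok_large => //; rewrite /K; lra.
(* 99/70 is slightly larger than the square root of 2. *)
have lK : l <= 29 / 140 * (K + 2).
  suff : K + 2 + 2 * l <= 99 / 70 * (K + 2) by lra.
  apply: le_of_sqr; first by rewrite /K; lra.
  by have := sqr_ge0 (K + 2); lra.
(* 161/72 is slightly larger than the square root of 5. *)
have Kl : 2 * K + 2 * l - 1 <= 161 / 72 * (2 * l + 5).
  apply: le_of_sqr; first lra.
  have h0 : 0 <= (2 * K + 2 * l - 1) ^+ 2 + 6 * l + 5 by rewrite !addr_ge0 ?sqr_ge0//; lra.
  have : 1 / 5 * ((2 * K + 2 * l - 1) ^+ 2 + 6 * l + 5) <=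
         (1 - x) * ((2 * K + 2 * l - 1) ^+ 2 + 6 * l + 5) by rewrite ler_wpM2r//; lra.
  by have := sqr_ge0 (2 * l + 5); rewrite /K; lra.
have k8 : (k < 9)%N.
  by rewrite -(ltr_nat R) -/K; lra.
(* The index bound lk read as a lower bound for x. *)
have lx (c : R) : c < 1 ->
   (2 * l + 5) ^+ 2 <= (1 - c) * (4 * ((K - 1) * (K - 1 + 2 * l + 1)) +
     2 * (2 * l + 3) * (l + 1)) ->
   c <= x.
  move=> c1 h; set B := 4 * _ + _ in h lk *.
  have B0 : 0 < B.
    by clear -hl K3; rewrite /B ltr_pwDr ?mulr_gt0 ?mulr_ge0//; rewrite /K; lra.
  have : (1 - x) * B <= (1 - c) * B by apply: le_trans lk h.
  by rewrite ler_pM2r//; lra.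
(* The bounds to be checked are quadratic in l; this product makes them
   linear. *)
have hq (lm : R) : l <= lm -> 0 <= (l - 1 / 2) * (lm - l) by move=> h; rewrite mulr_ge0//; lra.
clear nP Kl; move: k2 k8 @K K3 lK lx hq q2; clear -hl x0 x4.
case: k => [|[|[|[|[|[|[|[|[|//]]]]]]]]] // _ _ K K3 lK lx hq q2; rewrite /K in lK lx *.
  (* Now lm is (29/140) (k + 2), possibly rounded up, c a rational lower
     bound for x, and the other parameters are the quotients of
     [two_step_ok_small]. *)
- have lm : l <= 29 / 28 by lra.
  have cx : 34 / 125 <= x.
    rewrite leNgt; apply/negP => xc.
    have : 2 * (l + 2) * x ^+ 2 <= 2 * (29 / 28 + 2) * (34 / 125) ^+ 2.
      by apply: ler_pM; rewrite ?sqr_ge0//; [lra|lra|apply: le_sqr; lra].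
    lra.
  clear -hl lm cx; apply: (@two_step_ok_small l x 3 (29 / 28) (34 / 125) (4 / 5) (5 / 6)
    (141 / 170) (3 / 4)); rewrite ?hl ?lm ?cx//; lra.
- have lm : l <= 5 / 4 by lra.
  have cx : 9 / 20 <= x by apply: lx; [lra|have := hq _ lm; lra].
  clear -hl lm cx; apply: (@two_step_ok_small l x 4 (5 / 4) (9 / 20) (5 / 6) (6 / 7) (5 / 6)
    (4 / 5)); rewrite ?hl ?lm ?cx//; lra.
- have lm : l <= 29 / 20 by lra.
  have cx : 59 / 100 <= x by apply: lx; [lra|have := hq _ lm; lra].
  clear -hl lm cx; apply: (@two_step_ok_small l x 5 (29 / 20) (59 / 100) (6 / 7) (7 / 8)
    (149 / 178) (5 / 6)); rewrite ?hl ?lm ?cx//; lra.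
- have lm : l <= 5 / 3 by lra.
  have cx : 17 / 25 <= x by apply: lx; [lra|have := hq _ lm; lra].
  clear -hl lm cx; apply: (@two_step_ok_small l x 6 (5 / 3) (17 / 25) (7 / 8) (8 / 9)
    (26 / 31) (6 / 7)); rewrite ?hl ?lm ?cx//; lra.
- have lm : l <= 15 / 8 by lra.
  have cx : 37 / 50 <= x by apply: lx; [lra|have := hq _ lm; lra].
  clear -hl lm cx; apply: (@two_step_ok_small l x 7 (15 / 8) (37 / 50) (8 / 9) (9 / 10)
    (79 / 94) (7 / 8)); rewrite ?hl ?lm ?cx//; lra.
- have lm : l <= 21 / 10 by lra.
  have cx : 77 / 100 <= x by apply: lx; [lra|have := hq _ lm; lra].
  clear -hl lm cx; apply: (@two_step_ok_small l x 8 (21 / 10) (77 / 100) (9 / 10) (10 / 11)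
    (37 / 44) (8 / 9)); rewrite ?hl ?lm ?cx//; lra.
Qed.

End Far.

(** * Polynomial inequalities in Bernstein form *)

(** [mons M i j d] adds to the context the instances of [M] for all monomials
    of degree at most [i] in the first variable and homogeneous of degree [d] in
    the other two, the middle exponent being at most [j].  A polynomial
    inequality whose expansion has coefficients of one sign is then linear in
    the context. *)
Ltac mons M i j d :=
  let rec inner a b :=
    (pose proof (M a b (d - b)%N);
     match b with O => idtac | S ?b' => inner a b' end) in
  let rec outer a :=
    (inner a j; match a with O => idtac | S ?a' => outer a' end) in
  outer i.

Section Certificates.
Variable R : realFieldType.
Implicit Types m p q Z : R.

(** In the inequalities below p and q are barycentric coordinates of an
    interval of Z = (m + 3)^2 x^2, and both sides are homogeneous in (p, q).
    After expansion all coefficients have one sign, so nonnegativity of the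
    monomials is all that is used. *)
Lemma monomial_ge0 m p q : 0 <= m -> 0 <= p -> 0 <= q ->
  forall i j k, 0 <= m ^+ i * p ^+ j * q ^+ k.
Proof. by move=> *; rewrite !mulr_ge0 ?exprn_ge0. Qed.

Lemma bernstein_outer m p q : 0 <= m -> 0 <= p -> 0 <= q ->
  0 <= ((m + 1) * (m + 5) * (9 / 8 * q + 2 * p) - (m + 3) ^+ 2 * (p + q)) * (m + 3) ^+ 4 *
    (m + 4) ^+ 2 * (p + q) ^+ 2 +
   (m + 1) * (m + 7) * (m + 3) ^+ 2 * (p + q) * ((m + 3) ^+ 2 * (p + q) -
     (m + 5) * (9 / 8 * q + 2 * p)) ^+ 2 +
   (m + 1) * (m + 9) * (9 / 8 * q + 2 * p) * (3 * (m + 3) ^+ 2 * (p + q) -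
     (m + 7) * (9 / 8 * q + 2 * p)) ^+ 2.
Proof.
by move=> m0 p0 q0; have M := monomial_ge0 m0 p0 q0; mons M 8%N 3%N 3%N; lra.
Qed.

(** The polynomial [energy4_num] of the next part, homogenised in order to be
    evaluated at Z = (m + 3)^2 Y: the argument t stands for (m + 3)^2 and h
    for p + q. *)
Definition energy4_hom m t Z h :=
  (m + 4) ^+ 2 * t ^+ 2 * h ^+ 2 * (t ^+ 2 * h ^+ 2 - 2 * (m + 1) * t * Z * h +
    (m + 1) * (m + 5) * Z ^+ 2)
  - (m + 1) * (m + 7) * t * h * (t * h - Z) * (t * h - (m + 5) * Z) ^+ 2
  - (m + 1) * (m + 9) * Z * (t * h - Z) * (3 * t * h - (m + 7) * Z) ^+ 2.

Lemma bernstein_inner m p q : 0 <= m -> 0 <= p -> 0 <= q ->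
  energy4_hom m ((m + 3) ^+ 2) (9 / 10 * p) (p + q) <=
  ((m + 3) ^+ 2 * (p + q) - (m + 3) * (9 / 10 * p)) ^+ 2 * (m + 3) ^+ 4 * (p + q) ^+ 2 *
    (m + 4) ^+ 2.
Proof.
move=> m0 p0 q0; have M := monomial_ge0 m0 p0 q0; mons M 10%N 4%N 4%N; rewrite /energy4_hom.
by lra.
Qed.

Lemma bernstein_box_energy m p q : 0 <= m -> 0 <= p -> 0 <= q ->
  (m + 6) ^+ 2 * (m + 3) ^+ 2 * energy4_hom m ((m + 3) ^+ 2) (9 / 10 * q + 9 / 8 * p) (p + q) <=
  (m + 6) ^+ 2 * (m + 2) ^+ 2 * (m + 4) ^+ 2 * (m + 3) ^+ 8 * (p + q) ^+ 4 +
  (m + 3) ^+ 6 * ((m + 3) ^+ 2 * (p + q) - (9 / 10 * q + 9 / 8 * p)) *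
     (9 / 10 * q + 9 / 8 * p) * (m + 1) * (m + 13) * 25 * (p + q) ^+ 2.
Proof.
move=> m0 p0 q0; have M := monomial_ge0 m0 p0 q0; mons M 14%N 4%N 4%N; rewrite /energy4_hom.
by lra.
Qed.

Lemma bernstein_box_jump m p q : 0 <= m -> 0 <= p -> 0 <= q ->
  0 <= 20 * (m + 3) ^+ 4 * (p + q) ^+ 2 - 20 * (m + 9) * (m + 3) ^+ 2 *
    (9 / 10 * q + 9 / 8 * p) * (p + q)
   + 2 * (m + 9) * (m + 11) * (9 / 10 * q + 9 / 8 * p) ^+ 2.
Proof.
by move=> m0 p0 q0; have M := monomial_ge0 m0 p0 q0; mons M 4%N 2%N 2%N; lra.
Qed.

Lemma bernstein_box_u4 m p q : 0 <= m -> 0 <= p -> 0 <= q ->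
  0 <= (m + 3) * ((m + 5) * (m + 7) * (9 / 10 * q + 9 / 8 * p) ^+ 2
         - 6 * (m + 5) * (m + 3) ^+ 2 * (9 / 10 * q + 9 / 8 * p) * (p + q)
         + 3 * (m + 3) ^+ 4 * (p + q) ^+ 2)
     + (m + 2) * (m + 4) * (m + 3) ^+ 4 * (p + q) ^+ 2.
Proof.
by move=> m0 p0 q0; have M := monomial_ge0 m0 p0 q0; mons M 6%N 2%N 2%N; lra.
Qed.

Lemma bernstein_right_u5 m p q : 0 <= m -> 0 <= p -> 0 <= q ->
  (m + 7) * (m + 9) * (q + 9 / 8 * p) ^+ 2
         - 10 * (m + 7) * (m + 3) ^+ 2 * (q + 9 / 8 * p) * (p + q)
         + 15 * (m + 3) ^+ 4 * (p + q) ^+ 2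
     <= (m + 2) * (m + 4) * (m + 3) ^+ 4 * (p + q) ^+ 2.
Proof.
by move=> m0 p0 q0; have M := monomial_ge0 m0 p0 q0; mons M 6%N 2%N 2%N; lra.
Qed.

Lemma bernstein_left_u5 m p q : 0 <= m -> 0 <= p -> 0 <= q ->
  (p + q + (9 / 10 * q + p)) * ((m + 7) * (m + 9) * (9 / 10 * q + p) ^+ 2
         - 10 * (m + 7) * (m + 3) ^+ 2 * (9 / 10 * q + p) * (p + q)
         + 15 * (m + 3) ^+ 4 * (p + q) ^+ 2)
     <= 2 * ((m + 3) * (p + q) - (9 / 10 * q + p)) * (m + 4) * (m + 3) ^+ 4 * (p + q) ^+ 2.
Proof.
by move=> m0 p0 q0; have M := monomial_ge0 m0 p0 q0; mons M 6%N 3%N 3%N; lra.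
Qed.

End Certificates.

(** * Explicit terms and energies *)

Section Negative.
Variable R : realFieldType.
Implicit Types (m l x : R) (u : nat -> R) (n : nat).

(** The parameter m = 2 l - 1 keeps all the denominators monic and linear. *)
Lemma ultra_values m x u : 0 <= m -> ultra_seq ((m + 1) / 2) x u ->
  [/\ u 2%N = ((m + 3) * x ^+ 2 - 1) / (m + 2),
      u 3%N = x * ((m + 5) * x ^+ 2 - 3) / (m + 2),
      u 4%N = ((m + 5) * (m + 7) * (x ^+ 2) ^+ 2 - 6 * (m + 5) * x ^+ 2 + 3) /
              ((m + 2) * (m + 4)),
      u 5%N = x * ((m + 7) * (m + 9) * (x ^+ 2) ^+ 2 - 10 * (m + 7) * x ^+ 2 + 15) /
              ((m + 2) * (m + 4)) &
      u 6%N = ((m + 7) * (m + 9) * (m + 11) * (x ^+ 2) ^+ 3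
                - 15 * (m + 7) * (m + 9) * (x ^+ 2) ^+ 2
                + 45 * (m + 7) * x ^+ 2 - 15) / ((m + 2) * (m + 4) * (m + 6))].
Proof.
move=> m0 [_ e0 e1 uS].
(* Identifies the next term r with a proposed value s. *)
have next (a p q r s : R) : 0 < a + m + 1 ->
    (a + 2 * ((m + 1) / 2)) * r = 2 * (a + (m + 1) / 2) * x * q - a * p ->
    (a + m + 1) * s = (2 * a + m + 1) * x * q - a * p -> r = s.
  move=> ap h1 h2; apply: (@mulfI _ (a + m + 1)); first exact: lt0r_neq0.
  by rewrite h2; move: h1; lra.
have E2 : u 2%N = ((m + 3) * x ^+ 2 - 1) / (m + 2).
  apply: (next _ _ _ _ _ _ (uS 0%N)); first lra.
  by rewrite e0 e1; field; nz.
have E3 : u 3%N = x * ((m + 5) * x ^+ 2 - 3) / (m + 2).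
  apply: (next _ _ _ _ _ _ (uS 1%N)); first lra.
  by rewrite e1 E2; field; nz.
have E4 : u 4%N = ((m + 5) * (m + 7) * (x ^+ 2) ^+ 2 - 6 * (m + 5) * x ^+ 2 + 3) /
              ((m + 2) * (m + 4)).
  apply: (next _ _ _ _ _ _ (uS 2%N)); first lra.
  by rewrite E2 E3; field; nz.
have E5 : u 5%N = x * ((m + 7) * (m + 9) * (x ^+ 2) ^+ 2 - 10 * (m + 7) * x ^+ 2 + 15) /
              ((m + 2) * (m + 4)).
  apply: (next _ _ _ _ _ _ (uS 3%N)); first lra.
  by rewrite E3 E4; field; nz.
split => //.
apply: (next _ _ _ _ _ _ (uS 4%N)); first lra.
by rewrite E4 E5; field; nz.
Qed.

(** Numerator of the energy of index 4 divided by 1 - Y, where Y = x^2;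
    written as the energy of index 2 minus the losses of the next two steps. *)
Definition energy4_num m (Y : R) :=
  (m + 4) ^+ 2 * (1 - 2 * (m + 1) * Y + (m + 1) * (m + 5) * Y ^+ 2)
  - (m + 1) * (m + 7) * (1 - Y) * (1 - (m + 5) * Y) ^+ 2
  - (m + 1) * (m + 9) * Y * (1 - Y) * (3 - (m + 7) * Y) ^+ 2.

Lemma energy2 m x u : 0 <= m -> ultra_seq ((m + 1) / 2) x u ->
  energy x u 2 = (1 - x ^+ 2) * (1 - 2 * (m + 1) * x ^+ 2 + (m + 1) * (m + 5) * (x ^+ 2) ^+ 2)
    / (m + 2) ^+ 2.
Proof.
move=> m0 hu; have [E2 E3 _ _ _] := ultra_values m0 hu.
by rewrite /energy E2 E3; field; nz.
Qed.

Lemma energy4 m x u : 0 <= m -> ultra_seq ((m + 1) / 2) x u ->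
  energy x u 4 = (1 - x ^+ 2) * energy4_num m (x ^+ 2) / ((m + 2) * (m + 4)) ^+ 2.
Proof.
move=> m0 hu; have [_ _ E4 E5 _] := ultra_values m0 hu.
by rewrite /energy /energy4_num E4 E5; field; nz.
Qed.

(** The nontrivial factor of u_7 - u_5. *)
Definition jump_num m (Y : R) := 30 - 20 * (m + 9) * Y + 2 * (m + 9) * (m + 11) * Y ^+ 2.

(** Only the loss of the second of the two steps is kept; u_7 - u_5 has the
    factor 1 - x^2, since u_7 and u_5 agree at x = 1 and at x = -1. *)
Lemma energy6_le m x u : 0 <= m -> ultra_seq ((m + 1) / 2) x u ->
  energy x u 6 <= (1 - x ^+ 2) * (energy4_num m (x ^+ 2) / ((m + 2) * (m + 4)) ^+ 2 -
    (m + 1) * (m + 13) * x ^+ 2 * (1 - x ^+ 2) * jump_num m (x ^+ 2) ^+ 2 /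
      (4 * ((m + 2) * (m + 4) * (m + 6)) ^+ 2)).
Proof.
move=> m0 hu; have [_ _ _ E5 E6] := ultra_values m0 hu.
rewrite (energyS _ hu).
have : energy x u 5 <= energy x u 4 by apply: (energy_le hu).
rewrite (energy4 m0 hu) => h.
have d : u 7%N - u 5%N = - (m + 13) * x * (1 - x ^+ 2) * jump_num m (x ^+ 2) /
  (2 * ((m + 2) * (m + 4) * (m + 6))).
  have [_ _ _ /(_ 5%N) h7] := hu.
  have m7 : 0 < m + 7 by lra.
  apply: (@mulfI _ (m + 7)); first exact: lt0r_neq0.
  have -> : (m + 7) * (u 7%N - u 5%N) = (m + 13) * (x * u 6%N - u 5%N) by move: h7; lra.
  by rewrite E5 E6 /jump_num; field; nz.
rewrite d.
have -> : (m + 1) / 2 / (6 + (m + 1) / 2) *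
   (- (m + 13) * x * (1 - x ^+ 2) * jump_num m (x ^+ 2) /
     (2 * ((m + 2) * (m + 4) * (m + 6)))) ^+ 2 =
   (1 - x ^+ 2) * ((m + 1) * (m + 13) * x ^+ 2 * (1 - x ^+ 2) * jump_num m (x ^+ 2) ^+ 2 /
     (4 * ((m + 2) * (m + 4) * (m + 6)) ^+ 2)).
  by rewrite /jump_num; field; nz.
lra.
Qed.

End Negative.

(** * Troughs for nonpositive arguments *)

Section Negative.
Variable R : realFieldType.
Implicit Types (m l x : R) (u : nat -> R) (n : nat).

Lemma le_of_eq (a b : R) : a = b -> a <= b.
Proof. by move=> ->. Qed.

(** Turns an interval for Z into the two nonnegative variables of the
    Bernstein form. *)
Lemma barycentric (A B Z : R) : A < B -> A <= Z <= B ->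
  exists p q, [/\ 0 <= p, 0 <= q, p + q = 1 & A * q + B * p = Z].
Proof.
move=> AB /andP[AZ ZB]; exists ((Z - A) / (B - A)), ((B - Z) / (B - A)).
have BA : B - A != 0 by apply: lt0r_neq0; lra.
by split; [rewrite divr_ge0//; lra|rewrite divr_ge0//; lra|field|field].
Qed.

(** For k = 1, away from Z = 1, the energy of index 4 is already small
    enough. *)
Lemma energy4_outer m Y : 0 <= m -> Y <= 1 -> 9 / 8 <= (m + 3) ^+ 2 * Y <= 2 ->
  energy4_num m Y <= Y * ((m + 2) * (m + 4)) ^+ 2.
Proof.
move=> m0 Y1 hZ.
have [|p [q [p0 q0 pq ZE]]] := barycentric _ hZ; first lra.
have := bernstein_outer m0 p0 q0; rewrite ZE pq.
have t0 : 0 < (m + 3) ^+ 6 by rewrite exprn_gt0//; lra.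
set c := _ + _ => c0.
have cE : c = (m + 3) ^+ 6 * (((m + 1) * (m + 5) * Y - 1) * (m + 4) ^+ 2 +
   (m + 1) * (m + 7) * (1 - (m + 5) * Y) ^+ 2 +
   (m + 1) * (m + 9) * Y * (3 - (m + 7) * Y) ^+ 2) by rewrite /c; ring.
move: c0; rewrite cE pmulr_rge0// => c0.
have Y1' : 0 <= 1 - Y by lra.
by have := mulr_ge0 Y1' c0; rewrite /energy4_num; lra.
Qed.

Lemma energy4_homE m Y : energy4_hom m ((m + 3) ^+ 2) ((m + 3) ^+ 2 * Y) 1 = (m + 3) ^+ 8 *
  energy4_num m Y.
Proof. by rewrite /energy4_hom /energy4_num; ring. Qed.

(** The counterpart of [energy4_outer] for k = 2. *)
Lemma energy4_inner m Y : 0 <= m -> 0 <= (m + 3) ^+ 2 * Y <= 9 / 10 ->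
  energy4_num m Y <= (1 - (m + 3) * Y) ^+ 2 * (m + 4) ^+ 2.
Proof.
move=> m0 hZ.
have [|p [q [p0 q0 pq ZE]]] := barycentric _ hZ; first lra.
have := bernstein_inner m0 p0 q0; rewrite mul0r add0r in ZE; rewrite ZE pq energy4_homE.
have t0 : 0 < (m + 3) ^+ 8 by rewrite exprn_gt0//; lra.
move=> h; rewrite -(ler_pM2l t0); apply: le_trans h _.
by apply: le_of_eq; ring.
Qed.

(** Around Z = 1, where u_1 = u_2, the energy of index 4 is too large, at
    least for small m: for m = 0 one has u_5 = u_1 there. The energy of index
    6 is small enough, for both k = 1 and k = 2. *)
Lemma energy6_box m Y : 0 <= m -> 0 <= Y -> Y <= 1 -> 9 / 10 <= (m + 3) ^+ 2 * Y <= 9 / 8 ->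
  energy4_num m Y / ((m + 2) * (m + 4)) ^+ 2 -
    (m + 1) * (m + 13) * Y * (1 - Y) * jump_num m Y ^+ 2 /
      (4 * ((m + 2) * (m + 4) * (m + 6)) ^+ 2)
  <= 1 / (m + 3) ^+ 2.
Proof.
move=> m0 Y0 Y1 hZ.
have [|p [q [p0 q0 pq ZE]]] := barycentric _ hZ; first lra.
have t0 : 0 < (m + 3) ^+ 8 by rewrite exprn_gt0//; lra.
have g10 : 10 <= jump_num m Y.
  have := bernstein_box_jump m0 p0 q0; rewrite ZE pq.
  have t4 : 0 < (m + 3) ^+ 4 by rewrite exprn_gt0//; lra.
  by move=> h; rewrite -(ler_pM2l t4) /jump_num; lra.
have g100 : 100 <= jump_num m Y ^+ 2.
  by have h : 10 ^+ 2 <= jump_num m Y ^+ 2; [apply: le_sqr|lra].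
have := bernstein_box_energy m0 p0 q0; rewrite ZE pq energy4_homE => h.
have {}h : (m + 6) ^+ 2 * (m + 3) ^+ 2 * energy4_num m Y <=
  (m + 6) ^+ 2 * (m + 2) ^+ 2 * (m + 4) ^+ 2 +
  (m + 3) ^+ 2 * (1 - Y) * Y * (m + 1) * (m + 13) * 25.
  rewrite -(ler_pM2l t0); apply: le_trans (le_trans _ h) _; first by apply: le_of_eq; ring.
  by apply: le_of_eq; ring.
have P : 0 < 4 * ((m + 2) * (m + 4) * (m + 6)) ^+ 2 by
  rewrite mulr_gt0 ?exprn_gt0 ?mulr_gt0//; lra.
have T : 0 < (m + 3) ^+ 2 by rewrite exprn_gt0//; lra.
rewrite ler_pdivlMr// mulrC -(ler_pM2r P).
have -> : (m + 3) ^+ 2 * (energy4_num m Y / ((m + 2) * (m + 4)) ^+ 2 -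
    (m + 1) * (m + 13) * Y * (1 - Y) * jump_num m Y ^+ 2 /
      (4 * ((m + 2) * (m + 4) * (m + 6)) ^+ 2)) *
    (4 * ((m + 2) * (m + 4) * (m + 6)) ^+ 2) =
  4 * ((m + 6) ^+ 2 * (m + 3) ^+ 2 * energy4_num m Y) -
    (m + 3) ^+ 2 * ((m + 1) * (m + 13) * Y * (1 - Y)) * jump_num m Y ^+ 2.
  by field; nz.
have w0 : 0 <= (m + 3) ^+ 2 * ((m + 1) * (m + 13) * Y * (1 - Y)).
  by clear -m0 Y0 Y1; rewrite !mulr_ge0 ?sqr_ge0//; lra.
by have := ler_wpM2l w0 g100; lra.
Qed.

(** When x^2 = 1 the energy no longer controls single terms, but then it is
    nonpositive from the start, which makes u geometric of ratio x. *)
Lemma ultra_ge_N1 l x u n : ultra_seq l x u -> x ^+ 2 <= 1 -> -1 <= u n.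
Proof.
move=> hu; have [_ e0 e1 _] := hu; rewrite le_eqVlt => /orP[/eqP x1|x1]; last first.
  apply: (energy_tail hu ler01 x1 (m := 0%N)) => //.
  by rewrite /energy e0 e1; lra.
have En j : energy x u j <= 0.
  by apply: le_trans (energy_le hu (leq0n j)) _; rewrite /energy e0 e1; lra.
have sq j : u j ^+ 2 = 1.
  elim: j => [|j ih]; first by rewrite e0 expr1n.
  have h := En j; rewrite /energy in h.
  have : (u j.+1 - x * u j) ^+ 2 <= 0.
    have : u j ^+ 2 * x ^+ 2 = 1 by rewrite ih x1 mul1r.
    by lra.
  rewrite le_eqVlt ltNge sqr_ge0 orbF sqrf_eq0 subr_eq0 => /eqP->.
  by rewrite exprMn x1 ih mul1r.
have := sq n; have := sqr_ge0 (u n + 1); nra.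
Qed.

Lemma u4_box m Y : 0 <= m -> 9 / 10 <= (m + 3) ^+ 2 * Y <= 9 / 8 ->
  - (1 / (m + 3)) <= ((m + 5) * (m + 7) * Y ^+ 2 - 6 * (m + 5) * Y + 3) / ((m + 2) * (m + 4)).
Proof.
move=> m0 hZ; have [|p [q [p0 q0 pq ZE]]] := barycentric _ hZ; first lra.
have := bernstein_box_u4 m0 p0 q0; rewrite ZE pq.
have t4 : 0 < (m + 3) ^+ 4 by rewrite exprn_gt0//; lra.
set c := _ + _ => c0.
have cE : c = (m + 3) ^+ 4 * ((m + 3) * ((m + 5) * (m + 7) * Y ^+ 2 - 6 * (m + 5) * Y + 3) +
  (m + 2) * (m + 4)) by rewrite /c; ring.
move: c0; rewrite cE pmulr_rge0// => c0.
rewrite ler_pdivlMr ?mulr_gt0//; [|lra|lra].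
have m3 : 0 < m + 3 by lra.
rewrite -(ler_pM2l m3).
have -> : (m + 3) * (- (1 / (m + 3)) * ((m + 2) * (m + 4))) = - ((m + 2) * (m + 4)) by field;
  nz.
lra.
Qed.

(** The condition (2 l + 2) x <= -1 is u_1 <= u_2, that is Z >= 1. The terms
    u_2 and u_3 are compared directly; from then on the energy of index 2, 4
    or 6 is used according to the size of Z, together with u_4 and u_5 in the
    last case. *)
Lemma trough1 l x u n : ultra_seq l x u -> -1 <= x -> (2 * l + 2) * x <= -1 ->
  (1 <= n)%N -> u 1%N <= u n.
Proof.
move=> hu xge xle n1; have [hl e0 e1 _] := hu; rewrite e1.
move: xge; rewrite le_eqVlt => /orP[/eqP xE|xgt].
  by rewrite -xE; apply: (ultra_ge_N1 _ hu); rewrite -xE; lra.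
pose m := 2 * l - 1; have m0 : 0 <= m by rewrite /m; lra.
have lE : l = (m + 1) / 2 by rewrite /m; lra.
have xle' : (m + 3) * x <= -1 by rewrite /m; lra.
clearbody m; move: hu {hl xle}; rewrite {}lE => hu.
have x0 : x < 0.
  rewrite ltNge; apply/negP => x0.
  have : 0 <= (m + 3) * x by rewrite mulr_ge0//; lra.
  lra.
have Y1 : x ^+ 2 < 1 by nra.
have Y1' : 0 <= 1 - x ^+ 2 by lra.
have Y0 := sqr_ge0 x.
have v0 : 0 <= - x by lra.
have yge : 1 / (m + 3) <= - x by rewrite ler_pdivrMr; lra.
have Zge : 1 <= (m + 3) ^+ 2 * x ^+ 2.
  have : 1 ^+ 2 <= ((m + 3) * - x) ^+ 2 by apply: le_sqr => //; lra.
  by rewrite expr1n; lra.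
have m2 : 0 < m + 2 by lra.
case: n n1 => [//|[_|]]; first by rewrite e1.
case=> [|[|n]] _.
- have [-> _ _ _ _] := ultra_values m0 hu; rewrite ler_pdivlMr//.
  have : 0 <= (1 - x) * (- 1 - (m + 3) * x) by rewrite mulr_ge0//; lra.
  lra.
- have [_ -> _ _ _] := ultra_values m0 hu; rewrite ler_pdivlMr// ler_nM2l//.
  have : (m + 5) * x ^+ 2 <= (m + 5) * 1 by rewrite ler_wpM2l//; lra.
  lra.
have D0 : 0 < (m + 2) * (m + 4) by rewrite mulr_gt0//; lra.
have [Z2|Z2] := leP 2 ((m + 3) ^+ 2 * x ^+ 2).
  rewrite -[x]opprK; apply: (energy_tail hu v0 Y1 (m := 2)) => //.
  rewrite (energy2 m0 hu) ler_pdivrMr ?exprn_gt0// sqrrN -[X in _ <= X]mulrA ler_wpM2l//.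
  have : 0 <= (1 - x ^+ 2) * ((m + 1) * (m + 5) * x ^+ 2 - 1).
    rewrite mulr_ge0//.
    have : 9 * x ^+ 2 <= (m + 3) ^+ 2 * x ^+ 2 by rewrite ler_wpM2r//; have := sqr_ge0 m; lra.
    lra.
  lra.
have [Z1|Z1] := leP (9 / 8) ((m + 3) ^+ 2 * x ^+ 2).
  rewrite -[x]opprK; apply: (energy_tail hu v0 Y1 (m := 4)) => //.
  rewrite (energy4 m0 hu) ler_pdivrMr ?exprn_gt0// sqrrN -[X in _ <= X]mulrA ler_wpM2l//.
  by apply: energy4_outer => //; [exact: ltW|rewrite Z1 ltW].
have box : 9 / 10 <= (m + 3) ^+ 2 * x ^+ 2 <= 9 / 8 by apply/andP; split; lra.
case: n => [|[|n]].
- have [_ _ -> _ _] := ultra_values m0 hu; apply: le_trans (u4_box m0 box); lra.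
- have [_ _ _ -> _] := ultra_values m0 hu; rewrite ler_pdivlMr// ler_nM2l//.
  have hZ : 1 <= (m + 3) ^+ 2 * x ^+ 2 <= 9 / 8 by apply/andP; split; lra.
  have [|p [q [p0 q0 pq ZE]]] := barycentric _ hZ; first lra.
  rewrite mul1r in ZE; have := bernstein_right_u5 m0 p0 q0; rewrite ZE pq.
  have t4 : 0 < (m + 3) ^+ 4 by rewrite exprn_gt0//; lra.
  by move=> h; rewrite -(ler_pM2l t4); lra.
rewrite -[x]opprK; apply: (energy_tail hu v0 Y1 (m := 6)) => //.
apply: le_trans (energy6_le m0 hu) _; rewrite ler_wpM2l//.
apply: le_trans (energy6_box m0 Y0 (ltW Y1) box) _.
by have := le_sqr _ yge; rewrite expr_div_n expr1n; apply; rewrite divr_ge0//; lra.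
Qed.

(** Here Z <= 1. The value - u_2 is at least 1 / (m + 3), so that
    [energy6_box] serves again near Z = 1. *)
Lemma trough2_neg l x u n : ultra_seq l x u -> x <= 0 -> -1 <= (2 * l + 2) * x ->
  u 2%N <= u 3%N -> (2 <= n)%N -> u 2%N <= u n.
Proof.
move=> hu x0 xge d2 n2; have [hl e0 e1 _] := hu.
pose m := 2 * l - 1; have m0 : 0 <= m by rewrite /m; lra.
have lE : l = (m + 1) / 2 by rewrite /m; lra.
have xge' : -1 <= (m + 3) * x by rewrite /m; lra.
clearbody m; move: hu {hl xge}; rewrite {}lE => hu.
have Y0 := sqr_ge0 x.
have m3 : 0 < m + 3 by lra.
have yle : - x <= 1 / (m + 3) by rewrite ler_pdivlMr//; lra.
have Zle : (m + 3) ^+ 2 * x ^+ 2 <= 1.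
  have : ((m + 3) * - x) ^+ 2 <= 1 ^+ 2 by apply: le_sqr => //; [rewrite mulr_ge0|]; lra.
  by rewrite expr1n; lra.
have Y9 : 9 * x ^+ 2 <= (m + 3) ^+ 2 * x ^+ 2 by rewrite ler_wpM2r//; have := sqr_ge0 m; lra.
have Y1 : x ^+ 2 < 1 by lra.
have Y1' : 0 <= 1 - x ^+ 2 by lra.
have m2 : 0 < m + 2 by lra.
have D0 : 0 < (m + 2) * (m + 4) by rewrite mulr_gt0//; lra.
pose V := (1 - (m + 3) * x ^+ 2) / (m + 2).
have VE : u 2%N = - V by have [-> _ _ _ _] := ultra_values m0 hu; rewrite /V; field; nz.
have Vge : 1 / (m + 3) <= V.
  rewrite ler_pdivrMr// mulrAC ler_pdivlMr//; lra.
have V0 : 0 <= V by apply: le_trans Vge; rewrite divr_ge0//; lra.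
rewrite VE in d2 *.
case: n n2 => [//|[//|[_|[_|n _]]]]; rewrite ?VE// {VE}.
have [Z9|Z9] := leP ((m + 3) ^+ 2 * x ^+ 2) (9 / 10).
  apply: (energy_tail hu V0 Y1 (m := 4)) => //.
  rewrite (energy4 m0 hu) ler_pdivrMr ?exprn_gt0// -[X in _ <= X]mulrA ler_wpM2l//.
  have -> : V ^+ 2 * ((m + 2) * (m + 4)) ^+ 2 = (1 - (m + 3) * x ^+ 2) ^+ 2 * (m + 4) ^+ 2.
    by rewrite /V; field; nz.
  by apply: energy4_inner => //; rewrite Z9 mulr_ge0// sqr_ge0.
have box : 9 / 10 <= (m + 3) ^+ 2 * x ^+ 2 <= 9 / 8 by apply/andP; split; lra.
case: n => [|[|n]].
- have [_ _ -> _ _] := ultra_values m0 hu; apply: le_trans (u4_box m0 box); lra.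
- have [_ _ _ -> _] := ultra_values m0 hu; rewrite ler_pdivlMr//.
  set N := (m + 7) * (m + 9) * (x ^+ 2) ^+ 2 - 10 * (m + 7) * x ^+ 2 + 15.
  rewrite mulNr lerNl -mulNr.
  have [N0|N0] := leP N 0.
    by apply: (@le_trans _ _ 0); [rewrite mulr_ge0_le0//; lra|rewrite mulr_ge0// ltW].
  have hZ : 9 / 10 <= (m + 3) ^+ 2 * x ^+ 2 <= 1 by apply/andP; split; lra.
  have [|p [q [p0 q0 pq ZE]]] := barycentric _ hZ; first lra.
  rewrite mul1r in ZE; have := bernstein_left_u5 m0 p0 q0; rewrite ZE pq => h.
  have t4 : 0 < (m + 3) ^+ 4 by rewrite exprn_gt0//; lra.
  have {}h : (1 + (m + 3) ^+ 2 * x ^+ 2) * N <= 2 * ((m + 3) - (m + 3) ^+ 2 * x ^+ 2) * (m + 4).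
    by rewrite -(ler_pM2l t4) /N; lra.
  have ya : 2 * (m + 3) * - x <= 1 + (m + 3) ^+ 2 * x ^+ 2.
    by have := sqr_ge0 ((m + 3) * x + 1); lra.
  have m3' : 0 < 2 * (m + 3) by lra.
  rewrite -(ler_pM2l m3'); clear d2.
  apply: (@le_trans _ _ ((1 + (m + 3) ^+ 2 * x ^+ 2) * N)).
    by rewrite mulrA ler_wpM2r// ltW.
  apply: le_trans h _; rewrite /V.
  by apply: le_of_eq; field; nz.
apply: (energy_tail hu V0 Y1 (m := 6)) => //.
apply: le_trans (energy6_le m0 hu) _; rewrite ler_wpM2l//.
apply: le_trans (energy6_box m0 Y0 (ltW Y1) box) _.
by have := le_sqr _ Vge; rewrite expr_div_n expr1n; apply; rewrite divr_ge0//; lra.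
Qed.

End Negative.

(** * The first trough is the minimum *)

Section Main.
Variable R : archiRealFieldType.
Implicit Types (m l x : R) (u : nat -> R) (n : nat).

(** For small x the excess e is explicit and nonpositive, and small with x;
    the generic conditions of [two_step], which allow - e to be as large as
    (1 - x) (- u_2), are too demanding there. *)
Lemma trough2_pos l x u n : ultra_seq l x u -> 0 <= x < 1 ->
  u 2%N <= u 1%N -> u 2%N <= u 3%N -> (2 <= n)%N -> u 2%N <= u n.
Proof.
move=> hu /andP[x0 x1] hm hp n2; have [hl e0 e1 uS] := hu.
have [P|nP] := leP (2 * (2 + 2) ^+ 2) ((2 + 2 + 2 * l) ^+ 2).
  have K1 : 1 <= 2 :> R by lra.
  have ok := two_step_ok_large hl x0 K1 P.
  by apply: (trough_two_step hu _ _ hm hp ok n2); rewrite ?x0.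
have lle : l <= 29 / 35.
  (* The square root of 2 again. *)
  suff : 2 + 2 + 2 * l <= 99 / 70 * (2 + 2) by lra.
  by apply: le_of_sqr; lra.
have [xq|xq] := leP (1 / 4) x.
  have b1 : 1 / 2 <= l <= 29 / 35 by rewrite hl.
  have b2 : 0 <= (1 / 4 : R) <= x by apply/andP; split; lra.
  have K1 : 1 <= 2 :> R by lra.
  have r1 : 2 + 1 = 3 / 4 * (2 + 1 + 1) :> R by lra.
  have r2 : 2 + 2 = 4 / 5 * (2 + 2 + 1) :> R by lra.
  have gm : 2 + 1 + 29 / 35 = 134 / 163 * (2 + 1 + 2 * (29 / 35)) :> R by lra.
  have tm : 2 = 2 / 3 * (2 + 1) :> R by lra.
  have ok : two_step_ok l x 2 by apply: (two_step_ok_small b1 b2 K1 r1 r2 gm tm); lra.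
  by apply: (trough_two_step hu _ _ hm hp ok n2); rewrite ?x0.
case: n n2 => [//|[//|[_|[_|n _]]]] //.
have k2 : (0 < 2)%N by [].
have := trough_defect hu k2 x1 hm hp; have v0 := trough_neg hu k2 x1 hm hp.
have := two_step_energy 2 hu; cbv zeta.
set v := - u 2%N; set e := u 3%N - x * u 2%N => En /andP[e1' _].
have v0' : 0 <= v by rewrite /v oppr_ge0.
have eE : e = - x * (1 + v) / (1 + l).
  have h1 : 1 + l != 0 by apply: lt0r_neq0; lra.
  have h2 : 2 + 2 * l != 0 by apply: lt0r_neq0; lra.
  apply: (mulfI h1); rewrite mulrCA mulfV// mulr1 /e /v.
  by have := uS 1%N; rewrite e1; lra.
have vE : (2 * l + 1) * v = 1 - (2 * l + 2) * x ^+ 2.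
  by rewrite /v; have := uS 0%N; rewrite e0 e1; lra.
have en : e <= 0.
  by rewrite eE mulNr mulNr oppr_le0 !mulr_ge0 ?invr_ge0//; lra.
have x2 : x ^+ 2 < 1 by nra.
rewrite -[u 2%N]opprK -/v; apply: (energy_tail hu v0' x2 (m := 4)) => //.
rewrite {}En.
set Y := (1 - x ^+ 2) * v + x * e.
have Yge : (1 - x) * v <= Y.
  by have := ler_wpM2l x0 e1'; rewrite /Y; lra.
have Y0 : 0 <= Y by apply: le_trans Yge; rewrite mulr_ge0//; lra.
have key : - e * (2 / (2 + l)) <= 33 / 50 * ((1 - x) * v).
  clear -hl lle x0 xq eE vE.
  have P : 0 < (1 + l) * (2 + l) * (2 * l + 1) by rewrite !mulr_gt0//; lra.
  rewrite -(ler_pM2l P) eE.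
  have -> : (1 + l) * (2 + l) * (2 * l + 1) * (- (- x * (1 + v) / (1 + l)) * (2 / (2 + l))) =
    2 * x * ((2 * l + 1) + (2 * l + 1) * v) by field; nz.
  have -> : (1 + l) * (2 + l) * (2 * l + 1) * (33 / 50 * ((1 - x) * v)) =
    33 / 50 * (1 + l) * (2 + l) * (1 - x) * ((2 * l + 1) * v) by ring.
  rewrite vE.
  have x4 : x ^+ 2 <= 1 / 16 by have := le_sqr x0 (ltW xq); lra.
  have h : 4 * x * (1 + x) <= 33 / 50 * (2 + l) * (1 - (2 * l + 2) * x ^+ 2).
    have : (2 + l) * ((2 * l + 2) * x ^+ 2) <= (2 + l) * ((2 * l + 2) * (1 / 16)).
      by rewrite !ler_wpM2l//; lra.
    have : 0 <= (l - 1 / 2) * (29 / 35 - l) by rewrite mulr_ge0//; lra.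
    lra.
  have w : 0 <= (1 + l) * (1 - x) by rewrite mulr_ge0//; lra.
  by have := ler_wpM2l w h; lra.
clear -hl x0 e1' v0' en Yge Y0 key; clearbody v e Y.
set A1 := 4 * l * (3%:R + l) / _; set A2 := 4 * l * (4%:R + l) / _.
(* (33/50)^2 is slightly less than 7/16, the least value of the first loss. *)
have A1ge : (33 / 50) ^+ 2 <= A1.
  have : 1 - (3 / (3 + 1)) ^+ 2 <= A1 by apply: loss_ge; lra.
  rewrite (_ : 3 / (3 + 1) = 3 / 4 :> R); first lra.
  by congr (_ / _); lra.
have A2E : A2 = 1 - (2 / (2 + l)) ^+ 2 by rewrite /A2; field; nz.
have A20 : 0 <= A2 by rewrite /A2 divr_ge0 ?sqr_ge0// !mulr_ge0//; lra.
set g := (3%:R + l) / _; have g0 : 0 <= g by rewrite divr_ge0//; lra.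
(* Since 1 - A2 is the square of 2 / (2 + l), what remains of e^2 after the
   second loss is covered by the first. *)
have s2 : A2 * (- e) ^+ 2 <= A2 * (2 * x * g * Y - e) ^+ 2.
  rewrite ler_wpM2l//; apply: le_sqr; first lra.
  by rewrite lerDr mulr_ge0// mulr_ge0// mulr_ge0.
have s1 : (- e * (2 / (2 + l))) ^+ 2 <= A1 * Y ^+ 2.
  apply: (@le_trans _ _ ((33 / 50 * Y) ^+ 2)).
    apply: le_sqr; first by rewrite mulr_ge0 ?divr_ge0//; lra.
    by apply: le_trans key _; rewrite ler_wpM2l//; lra.
  by rewrite exprMn ler_wpM2r ?sqr_ge0.
rewrite exprMn in s1; rewrite A2E in s2 *; lra.
Qed.

(** Troughs of index at least 3 occur only for nonnegative x: u_2 <= u_1 and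
    u_3 <= u_2 together exclude negative x. *)
Theorem trough_min l x u k n : ultra_seq l x u -> -1 <= x < 1 -> (0 < k)%N ->
  (forall i, (i < k)%N -> u i.+1 <= u i) -> u k <= u k.+1 -> u k <= u n.
Proof.
move=> hu /andP[xge x1] k0 dec hp; have [hl _ _ _] := hu.
have [kn|nk] := leqP k n; last first.
  elim: k nk {k0 hp} dec => // k ih; rewrite ltnS leq_eqVlt => /orP[/eqP->|nk] dec.
    exact: dec.
  by apply: le_trans (dec k (ltnSn k)) _; apply: ih => // i ik; apply: dec; rewrite ltnS ltnW.
have x1' : 0 < 1 - x by lra.
have u2E := ultra_diff12 hu.
case: k k0 kn dec hp => [//|[_|[_|k _]]] kn dec hp.
- apply: (trough1 hu) => //.
  have : (2 * l + 1) * (u 1%N - u 2%N) <= 0 by rewrite mulr_ge0_le0//; lra.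
  by rewrite u2E pmulr_rle0//; lra.
- have h12 : -1 <= (2 * l + 2) * x.
    have : 0 <= (2 * l + 1) * (u 1%N - u 2%N).
      by rewrite mulr_ge0 ?subr_ge0//; [lra|apply: (dec 1%N)].
    by rewrite u2E pmulr_rge0//; lra.
  have [xn|xp] := leP x 0; first exact: (trough2_neg hu).
  by apply: (trough2_pos hu) => //; [rewrite x1 ltW|exact: (dec 1%N)].
have x0 : 0 <= x.
  have d1 := dec 1%N isT; have d2 := dec 2%N isT.
  rewrite leNgt; apply/negP => xn.
  have h12 : 0 <= (2 * l + 2) * x + 1.
    by rewrite -(pmulr_rge0 _ x1') -u2E mulr_ge0 ?subr_ge0//; lra.
  have : 0 <= 2 * (l + 2) * x ^+ 2 + 2 * x - 1.
    by rewrite -(pmulr_rge0 _ x1') -(ultra_diff23 hu) mulr_ge0 ?subr_ge0//; lra.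
  have : 0 <= (- x) * ((2 * l + 2) * x + 1) by rewrite mulr_ge0//; lra.
  have : 0 <= (2 * l - 1) * - x by rewrite mulr_ge0//; lra.
  have : 0 <= - x * (1 + x) by rewrite mulr_ge0//; lra.
  lra.
have [x45|x45] := ltP x (4 / 5).
  by apply: (trough_far hu) => //; rewrite x0.
by apply: (trough_near_one hu) => //; rewrite x45.
Qed.

End Main.

(** * Polynomials given by three-term recurrences *)

Section Recurrences.
Variable R : realFieldType.
Implicit Types (a b c : nat -> R) (l x y : R) (n : nat).

(** Pairs of consecutive polynomials, so that the recursion is structural. *)
Fixpoint three_term a b c n : {poly R} * {poly R} :=
  if n is n'.+1 then
    let pq := three_term a b c n' in
    ((a n' *: 'X + (b n')%:P) * pq.1 - c n' *: pq.2, pq.1)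
  else (1, 0).

Definition recpoly a b c n := (three_term a b c n).1.

Lemma recpoly0 a b c : recpoly a b c 0 = 1. Proof. by []. Qed.

Lemma recpoly1 a b c : recpoly a b c 1 = a 0%N *: 'X + (b 0%N)%:P.
Proof. by rewrite /recpoly /= mulr1 scaler0 subr0. Qed.

Lemma recpolySS a b c n : recpoly a b c n.+2 =
  (a n.+1 *: 'X + (b n.+1)%:P) * recpoly a b c n.+1 - c n.+1 *: recpoly a b c n.
Proof. by []. Qed.

Lemma size_recpoly a b c n : (forall n, a n != 0) -> size (recpoly a b c n) = n.+1.
Proof.
move=> an0; have sz k : size (a k *: 'X + (b k)%:P) = 2%N.
  by rewrite -mul_polyC size_MXaddC polyC_eq0 (negPf (an0 k)) size_polyC an0.
suff : size (recpoly a b c n) = n.+1 /\ size (recpoly a b c n.+1) = n.+2 by case.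
elim: n => [|n [ih1 ih2]]; first by rewrite recpoly0 recpoly1 size_polyC oner_neq0 sz.
split=> //; rewrite recpolySS size_polyDl; first by rewrite size_mul -?size_poly_eq0 ?sz ?ih2.
rewrite size_polyN size_mul -?size_poly_eq0 ?sz ?ih2//=.
by apply: leq_ltn_trans (size_scale_leq _ _) _; rewrite ih1.
Qed.

(** The polynomials R_n^(alpha,alpha), for l = alpha + 1/2. *)
Definition ultra l := recpoly (fun n => 2 * (n%:R + l) / (n%:R + 2 * l)) (fun=> 0)
  (fun n => n%:R / (n%:R + 2 * l)).

(** Multiples of R_n^(alpha+1,alpha), for l = alpha + 1/2, normalized by
    [ultra_diff]. *)
Definition ujac l := recpoly (fun n => 2 * (n%:R + l + 1) / (n%:R + 2 * l + 1))
  (fun n => l / ((n%:R + l) * (n%:R + 2 * l + 1)))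
  (fun n => n%:R * (n%:R + l + 1) / ((n%:R + l) * (n%:R + 2 * l + 1))).

Lemma size_ultra l n : 0 < l -> size (ultra l n) = n.+1.
Proof.
move=> l0; apply: size_recpoly => k; have : 0 <= k%:R :> R by [].
by move=> k0; apply: lt0r_neq0; rewrite divr_gt0//; lra.
Qed.

Lemma size_ujac l n : 0 < l -> size (ujac l n) = n.+1.
Proof.
move=> l0; apply: size_recpoly => k; have : 0 <= k%:R :> R by [].
by move=> k0; apply: lt0r_neq0; rewrite divr_gt0//; lra.
Qed.

Lemma ultraSS l n : 0 < l -> (n.+1%:R + 2 * l) *: ultra l n.+2 =
  (2 * (n.+1%:R + l)) *: ('X * ultra l n.+1) - n.+1%:R *: ultra l n.
Proof.
move=> l0; have n0 : 0 < n.+1%:R :> R by [].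
have h : n.+1%:R + 2 * l != 0 by apply: lt0r_neq0; lra.
rewrite /ultra recpolySS addr0 scalerBr -scalerAl !scalerA.
by rewrite !(mulrC (n.+1%:R + 2 * l)) !divfK.
Qed.

Lemma ultra1 l : 0 < l -> ultra l 1 = 'X.
Proof.
move=> l0; rewrite /ultra recpoly1 addr0 !add0r divff ?scale1r//.
by apply: lt0r_neq0; lra.
Qed.

Lemma ultra_seqP l x : 1 / 2 <= l -> ultra_seq l x (fun n => (ultra l n).[x]).
Proof.
move=> hl; have l0 : 0 < l by lra.
split=> //; first by rewrite /ultra recpoly0 hornerE.
  by rewrite ultra1// hornerX.
move=> n; have := ultraSS n l0.
move: (ultra l n.+2) (ultra l n.+1) (ultra l n) => p q r /(congr1 (horner^~ x)) /=.
by rewrite !hornerE.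
Qed.

Lemma ultra_at1 l n : 1 / 2 <= l -> (ultra l n).[1] = 1.
Proof.
move=> hl; have [_ e0 e1 uS] := ultra_seqP 1 hl.
suff : (ultra l n).[1] = 1 /\ (ultra l n.+1).[1] = 1 by case.
elim: n => [//|n [ih1 ih2]]; split=> //.
have n0 : 0 < n.+1%:R :> R by [].
apply: (@mulfI _ (n.+1%:R + 2 * l)); first by apply: lt0r_neq0; lra.
by rewrite uS ih1 ih2; lra.
Qed.

Lemma ujac_rec l x n : 0 < l ->
  (n.+1%:R + 2 * l + 1) / (n.+1%:R + l + 1) * (ujac l n.+2).[x] +
   n.+1%:R / (n.+1%:R + l) * (ujac l n).[x] =
  (2 * x + l / ((n.+1%:R + l) * (n.+1%:R + l + 1))) * (ujac l n.+1).[x].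
Proof.
move=> l0; rewrite [ujac l n.+2]recpolySS -/(ujac l n.+1) -/(ujac l n).
move: (ujac l n.+1) (ujac l n) => p q; rewrite !hornerE.
have : 0 < n.+1%:R :> R by [].
move: (n.+1%:R : R) => a a0.
by field; nz.
Qed.

Lemma ujac1 l x : 0 < l -> (1 + 2 * l) / (1 + l) * (ujac l 1).[x] = 2 * x + 1 / (1 + l).
Proof. by move=> l0; rewrite /ujac recpoly1 !hornerE; field; nz. Qed.

(** Both sides satisfy the same recurrence, that of [diff_rec] and
    [ujac_rec]. *)
Lemma ultra_diff l x n : 1 / 2 <= l ->
  (ultra l n).[x] - (ultra l n.+1).[x] = (1 - x) * (ujac l n).[x].
Proof.
move=> hl; have l0 : 0 < l by lra.
have hu := ultra_seqP x hl; have [_ e0 e1 uS] := hu.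
suff : forall n, (ultra l n).[x] - (ultra l n.+1).[x] = (1 - x) * (ujac l n).[x] /\
   (ultra l n.+1).[x] - (ultra l n.+2).[x] = (1 - x) * (ujac l n.+1).[x].
  by move=> /(_ n)[].
elim=> [|k [ih1 ih2]].
  split; first by rewrite e0 e1 mulr1.
  have := ujac1 x l0; have := uS 0%N; rewrite e0 e1.
  have h1 : 1 + l != 0 by nz.
  have h2 : 1 + 2 * l != 0 by nz.
  move=> r1 r2; apply: (mulfI h2); apply: (mulfI (invr_neq0 h1)).
  rewrite mulrBr r1.
  have -> : (1 + l)^-1 * ((1 + 2 * l) * ((1 - x) * (ujac l 1).[x])) =
    (1 - x) * ((1 + 2 * l) / (1 + l) * (ujac l 1).[x]) by ring.
  by rewrite r2; field; nz.
split=> //.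
have k0 : 0 < k.+1%:R :> R by [].
have h1 : (k.+1%:R + 2 * l + 1) / (k.+1%:R + l + 1) != 0.
  by apply: lt0r_neq0; rewrite divr_gt0//; lra.
have d := diff_rec k hu; have := ujac_rec x k l0; rewrite ih1 ih2 in d.
rewrite (addrAC _ 1) (addrAC _ 1) in d => r.
apply: (mulfI h1).
have -> : (k.+1%:R + 2 * l + 1) / (k.+1%:R + l + 1) * ((1 - x) * (ujac l k.+2).[x]) =
  (1 - x) * ((k.+1%:R + 2 * l + 1) / (k.+1%:R + l + 1) * (ujac l k.+2).[x]) by ring.
move: d r; move: (_ / _) (k.+1%:R / _) (2 * x + _) => A C B d r.
have -> : A * (ujac l k.+2).[x] = B * (ujac l k.+1).[x] - C * (ujac l k).[x] by rewrite -r;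
  ring.
by rewrite mulrBr; lra.
Qed.

(** Inductive step for the derivative relations. It is stated in an arbitrary
    domain, primes being mere names, so that it is a computation with the two
    recurrences and not with polynomials. *)
Lemma ultra_deriv_step (K : idomainType) (a b X p q r p' q' r' : K) :
  a + b != 0 -> (a + b) * r = (2 * a + b) * X * q - a * p ->
  (a + b) * r' = (2 * a + b) * (q + X * q') - a * p' ->
  (a - 1 + b) * a * q = (a - 1 + b) * X * q' - a * p' ->
  (1 - X ^+ 2) * q' = a * (p - X * q) ->
  [/\ (a + b) * r' = (a + 1) * ((a + b) * q + X * q'),
     (a + b) * (a + 1) * r = (a + b) * X * r' - (a + 1) * q' &
     (1 - X ^+ 2) * r' = (a + 1) * (q - X * r)].
Proof.
move=> ab rec drec c1 c2.
have e1 : (a + b) * r' = (a + 1) * ((a + b) * q + X * q').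
  have -> : (a + b) * r' = (2 * a + b) * (q + X * q') +
      ((a - 1 + b) * a * q - (a - 1 + b) * X * q') by rewrite c1 drec; ring.
  by ring.
split=> //.
  have -> : (a + b) * X * r' = X * ((a + b) * r') by ring.
  have -> : (a + b) * (a + 1) * r = (a + 1) * ((a + b) * r) by ring.
  rewrite e1 rec.
  have -> : X * ((a + 1) * ((a + b) * q + X * q')) - (a + 1) * q' =
    (a + 1) * ((a + b) * X * q - (1 - X ^+ 2) * q') by ring.
  by rewrite c2; ring.
apply: (mulfI ab).
have -> : (a + b) * ((1 - X ^+ 2) * r') = (1 - X ^+ 2) * ((a + b) * r') by ring.
have -> : (a + b) * ((a + 1) * (q - X * r)) = (a + 1) * ((a + b) * q - X * ((a + b) * r)) by
  ring.
rewrite e1 rec.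
have -> : (1 - X ^+ 2) * ((a + 1) * ((a + b) * q + X * q')) =
  (a + 1) * ((a + b) * (1 - X ^+ 2) * q + X * ((1 - X ^+ 2) * q')) by ring.
by rewrite c2; ring.
Qed.

Lemma polyC_coefs l n : let a := (n%:R : {poly R}) in let b := (2 * l)%:P in
  [/\ (n%:R + 2 * l)%:P = a + b, (2 * (n%:R + l))%:P = 2 * a + b & (n%:R)%:P = a].
Proof.
split; last by rewrite rmorph_nat.
  by rewrite polyCD rmorph_nat.
by rewrite mulrDr polyCD polyCM !rmorph_nat.
Qed.

Lemma ultra_rec_poly l n : 0 < l -> let a := (n.+1%:R : {poly R}) in let b := (2 * l)%:P in
  (a + b) * ultra l n.+2 = (2 * a + b) * 'X * ultra l n.+1 - a * ultra l n.
Proof.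
move=> l0 a b; have [e1 e2 e3] := polyC_coefs l n.+1.
by have := ultraSS n l0; rewrite -!mul_polyC e1 e2 e3 mulrA.
Qed.

Lemma ultra_drec_poly l n : 0 < l -> let a := (n.+1%:R : {poly R}) in let b := (2 * l)%:P in
  (a + b) * (ultra l n.+2)^`() =
  (2 * a + b) * (ultra l n.+1 + 'X * (ultra l n.+1)^`()) - a * (ultra l n)^`().
Proof.
move=> l0 a b; have [e1 e2 e3] := polyC_coefs l n.+1.
have := congr1 deriv (ultraSS n l0); rewrite derivB !derivZ derivM derivX.
by rewrite -!mul_polyC e1 e2 e3 mul1r.
Qed.

Lemma polyC_coef_neq0 l n : 0 < l -> (n%:R : {poly R}) + (2 * l)%:P != 0.
Proof.
move=> l0; rewrite -(rmorph_nat polyC) -polyCD polyC_eq0.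
have n0 : 0 <= n%:R :> R by [].
by apply: lt0r_neq0; lra.
Qed.

(** The two structure relations are proved together: either one at n + 1 uses
    both at n. *)
Lemma ultra_deriv l n : 1 / 2 <= l -> let a := (n.+1%:R : {poly R}) in let b := (2 * l)%:P in
  (a - 1 + b) * a * ultra l n.+1 = (a - 1 + b) * 'X * (ultra l n.+1)^`() -
    a * (ultra l n)^`() /\
  (1 - 'X ^+ 2) * (ultra l n.+1)^`() = a * (ultra l n - 'X * ultra l n.+1).
Proof.
move=> hl; have l0 : 0 < l by lra.
move: n; elim=> [|n ih].
  by rewrite ultra1// /ultra recpoly0 derivX derivC; split; ring.
move=> a b; case: ih => c1 c2.
have aE : a = n.+1%:R + 1 by rewrite /a -natr1.
have ab := polyC_coef_neq0 n.+1 l0.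
have rec := ultra_rec_poly n l0.
have drec := ultra_drec_poly n l0.
have [_ d1 d2] := ultra_deriv_step ab rec drec c1 c2.
by rewrite aE addrK.
Qed.

(** Differentiating the second relation of [ultra_deriv] and eliminating the
    derivative of the neighbouring polynomial. *)
Lemma ultra_ode l n : 1 / 2 <= l -> let b := (2 * l)%:P in
  (1 - 'X ^+ 2) * (ultra l n)^`()^`() =
  (b + 1) * 'X * (ultra l n)^`() - (n%:R * (n%:R + b)) * ultra l n.
Proof.
move=> hl; have l0 : 0 < l by lra.
case: n => [|n] b; first by rewrite /ultra recpoly0 !derivC; ring.
have [c1 c2] := ultra_deriv n hl.
have ab := polyC_coef_neq0 n.+1 l0.
have rec := ultra_rec_poly n l0.
have [e1 _ _] := ultra_deriv_step ab rec (ultra_drec_poly n l0) c1 c2.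
have f : (1 - 'X ^+ 2) * (ultra l n.+1)^`() =
    (n.+1%:R + 2 * l)%:P * ('X * ultra l n.+1 - ultra l n.+2).
  have [-> _ _] := polyC_coefs l n.+1; rewrite -/b.
  have -> : (n.+1%:R + b) * ('X * ultra l n.+1 - ultra l n.+2) =
    (n.+1%:R + b) * 'X * ultra l n.+1 - (n.+1%:R + b) * ultra l n.+2 by ring.
  by rewrite rec c2; ring.
have gen (q r : {poly R}) (c : R) : (1 - 'X ^+ 2) * q^`() = c%:P * ('X * q - r) ->
    (1 - 'X ^+ 2) * q^`()^`() = 2 * 'X * q^`() + (c%:P * q + c%:P * 'X * q^`() - c%:P * r^`()).
  move=> /(congr1 deriv); rewrite !(derivM, derivB, derivXn, derivX, derivC).
  rewrite mul0r !add0r mul1r expr1 => h.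
  have -> : (1 - 'X ^+ 2) * q^`()^`() = (- ('X *+ 2) * q^`() + (1 - 'X ^+ 2) * q^`()^`())
    + 2 * 'X * q^`() by ring.
  by rewrite h; ring.
rewrite (gen _ _ _ f); have [-> _ _] := polyC_coefs l n.+1; rewrite -/b e1; ring.
Qed.

End Recurrences.

(** * Uniqueness of orthogonal sequences *)

Section Orthogonal.
Variable R : fieldType.
Implicit Types (B P : nat -> {poly R}) (p q : {poly R}).

(** The integral against a weight enters the algebra only through its
    linearity. *)
Definition linear_form (L : {poly R} -> R) := forall c p q, L (c *: p + q) = c * L p + L q.

Lemma linear_form0 L : linear_form L -> L 0 = 0.
Proof.
move=> lin; have := lin (-1) 0 0.
by rewrite scaler0 addr0 mulN1r addNr.
Qed.

Lemma linear_formB L p q : linear_form L -> L (p - q) = L p - L q.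
Proof. by move=> lin; rewrite addrC -scaleN1r lin mulN1r addrC. Qed.

Lemma linear_formZ L c p : linear_form L -> L (c *: p) = c * L p.
Proof. by move=> lin; rewrite -[c *: p]addr0 lin linear_form0// addr0. Qed.

Lemma reduce_lead n p q : (size p <= n.+1)%N -> size q = n.+1 ->
  exists c, (size (p - c *: q)%R <= n)%N.
Proof.
move=> sp sq; exists (p`_n / q`_n); apply/leq_sizeP => j.
rewrite coefB coefZ leq_eqVlt => /orP[/eqP<-|nj].
  have qn : q`_n != 0 by rewrite -[n]/(n.+1.-1) -sq -lead_coefE lead_coef_eq0 -size_poly_eq0 sq.
  by rewrite divfK// subrr.
have qj : q`_j = 0 by rewrite nth_default ?sq.
by rewrite (nth_default 0 (leq_trans sp nj)) qj mulr0 subr0.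
Qed.

(** A sequence of polynomials of sizes 1, 2, 3, ... spans all polynomials. *)
Lemma span_zero L B n p : linear_form L -> (forall j, size (B j) = j.+1) ->
  (forall j, (j < n)%N -> L (B j) = 0) -> (size p <= n)%N -> L p = 0.
Proof.
move=> lin sB; elim: n p => [|n ih] p L0.
  by rewrite leqn0 size_poly_eq0 => /eqP->; exact: linear_form0.
move=> sp; have [c sc] := reduce_lead sp (sB n).
rewrite -[p](subrK (c *: B n)) addrC lin L0// mulr0 add0r.
by apply: ih => // j jn; apply: L0; rewrite ltnW.
Qed.

Lemma orth_lower L B n p : linear_form L -> (forall j, size (B j) = j.+1) ->
  (forall i j, i != j -> L (B i * B j) = 0) -> (size p <= n)%N -> L (p * B n) = 0.
Proof.
move=> lin sB orth; apply: (@span_zero (fun q => L (q * B n)) B n p) => //.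
  by move=> c q r; rewrite mulrDl -scalerAl lin.
by move=> j jn; apply: orth; rewrite ltn_eqF.
Qed.

(** Subtract from P n the multiple of B n with the same leading coefficient.
    The rest T is orthogonal to all B j with j < n and has size at most n, so
    its own leading term would give a zero norm. *)
Lemma orth_unique L B P n : linear_form L -> (forall j, size (B j) = j.+1) ->
  (forall j, size (P j) = j.+1) ->
  (forall i j, i != j -> L (B i * B j) = 0) ->
  (forall i j, i != j -> L (P i * P j) = 0) ->
  (forall j, L (B j * B j) != 0) -> exists c, P n = c *: B n.
Proof.
move=> lin sB sP oB oP nB.
have [|c sc] := @reduce_lead n (P n) (B n) _ (sB n); first by rewrite sP.
exists c; apply/eqP; rewrite -subr_eq0; set T := P n - c *: B n in sc *.
have LT j : (j < n)%N -> L (T * B j) = 0.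
  move=> jn; rewrite /T mulrBl linear_formB// -scalerAl linear_formZ//.
  rewrite oB; last by rewrite gtn_eqF.
  by rewrite mulr0 subr0 mulrC (orth_lower lin sP oP)// sB.
apply: contraT => T0; have := size_poly_eq0 T; rewrite (negPf T0) => /negbT.
case sT : (size T) => [//|k] _.
have [|d sd] := @reduce_lead k T (B k) _ (sB k); first by rewrite sT.
have kn : (k < n)%N by rewrite -sT.
have := LT k kn; rewrite -[T](subrK (d *: B k)) mulrDl addrC -scalerAl lin.
rewrite (orth_lower lin sB oB sd) addr0 => /eqP; rewrite mulf_eq0 (negPf (nB k)) orbF.
by move=> /eqP d0; move: sd; rewrite d0 scale0r subr0 sT ltnn.
Qed.

End Orthogonal.

Section UltraNorm.
Variable R : realFieldType.
Implicit Types (p q : {poly R}).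

(** The three-term recurrence expresses the norm of each polynomial by the
    previous one, through the product of the two with the variable. *)
Lemma ultra_norm (L : {poly R} -> R) (l : R) n : 1 / 2 <= l -> linear_form L ->
  (forall i j, i != j -> L (ultra l i * ultra l j) = 0) -> L 1 != 0 ->
  L (ultra l n * ultra l n) != 0.
Proof.
move=> hl lin orth L1; have l0 : 0 < l by lra.
elim: n => [|n ih]; first by rewrite /ultra recpoly0 mulr1.
have n0 : 0 <= n%:R :> R by [].
have r2 := ultraSS n l0.
have o20 : L (ultra l n.+2 * ultra l n) = 0 by apply: orth; rewrite gtn_eqF// ltnW.
have e1 : 2 * (n.+1%:R + l) * L ('X * ultra l n.+1 * ultra l n) = n.+1%:R * L
  (ultra l n * ultra l n).
  have r : (n.+1%:R + 2 * l) *: (ultra l n.+2 * ultra l n) =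
      (2 * (n.+1%:R + l)) *: ('X * ultra l n.+1 * ultra l n) -
        n.+1%:R *: (ultra l n * ultra l n).
    by rewrite scalerAl r2 mulrBl -!scalerAl.
  have := congr1 L r; rewrite linear_formB// !linear_formZ// o20 mulr0 => /esym h.
  exact: subr0_eq h.
have e2 : (n%:R + 2 * l) * L (ultra l n.+1 * ultra l n.+1) = 2 * (n%:R + l) * L
  ('X * ultra l n.+1 * ultra l n).
  case: n {ih r2 o20 e1} n0 => [|n] n0.
    by rewrite ultra1// /ultra recpoly0 !mulr1 !add0r.
  have o02 : L (ultra l n * ultra l n.+2) = 0 by apply: orth; rewrite ltn_eqF// ltnW.
  have r : (n.+1%:R + 2 * l) *: (ultra l n.+2 * ultra l n.+2) =
      (2 * (n.+1%:R + l)) *: ('X * ultra l n.+2 * ultra l n.+1) -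
        n.+1%:R *: (ultra l n * ultra l n.+2).
    by rewrite scalerAl ultraSS// mulrBl -!scalerAl [in RHS](mulrAC _ (ultra l n.+2)).
  by have := congr1 L r; rewrite linear_formB// !linear_formZ// o02 mulr0 subr0.
apply/eqP => h; move: e2; rewrite h mulr0 => /esym/eqP.
rewrite mulf_eq0 (negPf (_ : 2 * (n%:R + l) != 0)) /=; last by nz.
move=> /eqP h2; move: e1; rewrite h2 mulr0 => /esym/eqP.
by rewrite mulf_eq0 (negPf ih) orbF pnatr_eq0.
Qed.

Lemma horner_inj p q : (forall x, p.[x] = q.[x]) -> p = q.
Proof.
move=> pq; apply/eqP; rewrite -subr_eq0; apply: contraT => nz0.
pose rs := [seq i%:R : R | i <- iota 0 (size (p - q)%R)].
have := @max_poly_roots _ (p - q) rs nz0.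
rewrite size_map size_iota ltnn => -> //.
  by apply/allP => y _; rewrite /root hornerD hornerN pq subrr.
by rewrite map_inj_uniq ?iota_uniq// => i j /eqP; rewrite eqr_nat => /eqP.
Qed.

Lemma ultra_diff_poly (l : R) n : 1 / 2 <= l ->
  (1 - 'X) * ujac l n = ultra l n - ultra l n.+1.
Proof.
move=> hl; apply: horner_inj => x; have := ultra_diff x n hl.
move: (ultra l n) (ultra l n.+1) (ujac l n) => p q r h.
by rewrite hornerM !hornerD !hornerN hornerX hornerC h.
Qed.

(** Summation by parts: (1 - x) times [ujac] of index j is a difference of
    two ultraspherical polynomials of index at least j, both orthogonal to
    lower degrees. *)
Lemma ujac_orth (L : {poly R} -> R) (l : R) : 1 / 2 <= l -> linear_form L ->
  (forall i j, i != j -> L (ultra l i * ultra l j) = 0) -> L 1 != 0 ->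
  (forall i j, i != j -> L ((1 - 'X) * (ujac l i * ujac l j)) = 0) /\
  (forall j, L ((1 - 'X) * (ujac l j * ujac l j)) != 0).
Proof.
move=> hl lin orth L1; have l0 : 0 < l by lra.
have sU j : size (ultra l j) = j.+1 by exact: size_ultra.
have sJ j : size (ujac l j) = j.+1 by exact: size_ujac.
have low i j : (i <= j)%N -> L ((1 - 'X) * (ujac l i * ujac l j)) = L (ujac l i * ultra l j).
  move=> ij; rewrite mulrCA ultra_diff_poly// mulrBr linear_formB//.
  by rewrite [X in _ - X](orth_lower lin sU orth) ?subr0// sJ.
have lt i j : (i < j)%N -> L ((1 - 'X) * (ujac l i * ujac l j)) = 0.
  by move=> ij; rewrite low ?(ltnW ij)// (orth_lower lin sU orth)// sJ.
split=> [i j|j].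
  by rewrite neq_ltn => /orP[/lt//|/lt]; rewrite [ujac l j * _]mulrC.
rewrite low//.
have [|c sc] := @reduce_lead _ j (ujac l j) (ultra l j) _ (sU j); first by rewrite sJ.
rewrite -[ujac l j](subrK (c *: ultra l j)) mulrDl addrC -scalerAl lin.
rewrite (orth_lower lin sU orth sc) addr0 mulf_neq0//; last exact: ultra_norm.
by apply: contraTneq sc => ->; rewrite scale0r subr0 sJ ltnn.
Qed.

End UltraNorm.

(** * Integration against the ultraspherical weight *)

Section Weight.
Variable R : realType.
Implicit Types (p q : {poly R}) (a : R).
Let mu := (@lebesgue_measure R).

Lemma powR_right0 a : 0 <= a -> x `^ a @[x --> (0:R)^'+] --> (0:R) `^ a.
Proof.
rewrite le_eqVlt => /orP[/eqP<-|a0].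
  under eq_fun do rewrite powRr0.
  by rewrite powRr0; exact: cvg_cst.
by rewrite powR0 ?gt_eqF//; exact: powR_cvg0.
Qed.

(** The weight is a power of 1 - x^2 and powers are continuous at 0 only from
    the right, so the base has to be shown to approach 0 from the right. *)
Lemma cvg_to_right0 (F : set_system R) (h : R -> R) : Filter F ->
  h @ F --> (0:R) -> (\forall x \near F, 0 < h x) -> h @ F --> (0:R)^'+.
Proof.
move=> FF h0 hpos A A0.
have := h0 _ A0; rewrite /nbhs /= => hA.
near=> x.
have : 0 < h x by near: x.
by near: x.
Unshelve. all: by end_near.
Qed.

(** On [-1, 1] this is the weight of the parameters (a, a). *)
Definition sqweight a (x : R) := (1 - x ^+ 2) `^ a.

Lemma onesub_left : (1 - x ^+ 2) @[x --> (1:R)^'-] --> (0:R)^'+.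
Proof.
apply: cvg_to_right0.
  have h : {for (1:R), continuous (fun x : R => 1 - x ^+ 2)}.
    by apply: cvgB; [exact: cvg_cst|exact: exprn_continuous].
  rewrite (_ : 0 = 1 - 1 ^+ 2 :> R); last by rewrite expr1n subrr.
  exact: cvg_at_left_filter.
near=> x.
have x1 : x < 1 by near: x; exact: nbhs_left_lt.
have x0 : 0 < x by near: x; exact: nbhs_left_gt.
by nra.
Unshelve. all: by end_near.
Qed.

Lemma onesub_right : (1 - x ^+ 2) @[x --> (-1:R)^'+] --> (0:R)^'+.
Proof.
apply: cvg_to_right0.
  have h : {for (-1:R), continuous (fun x : R => 1 - x ^+ 2)}.
    by apply: cvgB; [exact: cvg_cst|exact: exprn_continuous].
  rewrite (_ : 0 = 1 - (-1) ^+ 2 :> R); last by rewrite sqrrN expr1n subrr.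
  exact: cvg_at_right_filter.
near=> x.
have x1 : -1 < x by near: x; exact: nbhs_right_gt.
have x0 : x < 0 by near: x; apply: nbhs_right_lt.
by nra.
Unshelve. all: by end_near.
Qed.

Lemma sqweight_left a : 0 <= a -> sqweight a x @[x --> (1:R)^'-] --> sqweight a 1.
Proof.
move=> a0; rewrite /sqweight expr1n subrr.
exact: (cvg_comp _ _ onesub_left (powR_right0 a0)).
Qed.

Lemma sqweight_right a : 0 <= a -> sqweight a x @[x --> (-1:R)^'+] --> sqweight a (-1).
Proof.
move=> a0; rewrite /sqweight sqrrN expr1n subrr.
exact: (cvg_comp _ _ onesub_right (powR_right0 a0)).
Qed.

Lemma sqweight_derive a (x : R) : -1 < x < 1 ->
  is_derive x 1 (sqweight a) (- 2 * x * (a * (1 - x ^+ 2) `^ (a - 1))).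
Proof.
move=> /andP[x1 x2].
have h0 : 0 < 1 - x ^+ 2 by nra.
have d1 : is_derive x 1 (fun x : R => 1 - x ^+ 2) (- 2 * x).
  have -> : (fun x : R => 1 - x ^+ 2) = horner (1 - 'X ^+ 2).
    by apply/funext => y; rewrite hornerD hornerN hornerXn hornerC.
  apply: is_derive_eq.
  by rewrite derivB derivC derivXn sub0r hornerN hornerMn hornerX; ring.
have d2 := is_derive1_powR a h0.
have := @is_derive1_comp R (fun y => y `^ a) (fun y : R => 1 - y ^+ 2) x _ _ d2 d1.
by rewrite mulrC.
Qed.

Lemma sqweight_continuous_in a (x : R) : -1 < x < 1 -> {for x, continuous (sqweight a)}.
Proof.
move=> hx; apply/differentiable_continuous/derivable1_diffP.
by have [] := sqweight_derive a hx.
Qed.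

Lemma poly_sqweight_continuous p a : 0 <= a ->
  {within `[(-1:R), 1], continuous (fun x => p.[x] * sqweight a x)}.
Proof.
move=> a0; apply/continuous_within_itvP; first by lra.
have cp (x : R) : horner p y @[y --> x] --> p.[x] by exact: continuous_horner.
split.
- move=> x; rewrite in_itv /= => hx.
  by apply: cvgM; [exact: cp|exact: sqweight_continuous_in].
- by apply: cvgM; [exact: (cvg_at_right_filter (cp _))|exact: sqweight_right].
- by apply: cvgM; [exact: (cvg_at_left_filter (cp _))|exact: sqweight_left].
Qed.

Lemma poly_sqweight_integrable p a : 0 <= a ->
  mu.-integrable `[(-1:R), 1] (EFin \o (fun x => p.[x] * sqweight a x)).
Proof.
move=> a0; apply: continuous_compact_integrable; first exact: segment_compact.
exact: poly_sqweight_continuous.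
Qed.

Definition sqint a p : R := \int[mu]_(x in `[(-1:R), 1]) (p.[x] * sqweight a x).

Lemma sqintE a p : 0 <= a ->
  (\int[mu]_(x in `[(-1)%R, 1%R]) (p.[x] * sqweight a x)%R%:E = (sqint a p)%:E)%E.
Proof.
move=> a0; rewrite /sqint /Rintegral fineK//.
exact: (integrable_fin_num _ (poly_sqweight_integrable p a0)).
Qed.

Lemma sqint_linear a : 0 <= a -> linear_form (sqint a).
Proof.
move=> a0 c p q; rewrite /sqint.
have -> : (fun x => (c *: p + q).[x] * sqweight a x) =
  (fun x => c * (p.[x] * sqweight a x) + q.[x] * sqweight a x).
  by apply/funext => x; rewrite hornerD hornerZ mulrDl mulrA.
have icp : mu.-integrable `[(-1:R), 1] (EFin \o (fun x => c * (p.[x] * sqweight a x))).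
  have := poly_sqweight_integrable (c *: p) a0.
  rewrite (_ : (fun x => _) = (fun x => c * (p.[x] * sqweight a x)))//.
  by apply/funext => x; rewrite hornerZ mulrA.
rewrite RintegralD//; last exact: poly_sqweight_integrable.
by rewrite RintegralZl//; exact: poly_sqweight_integrable.
Qed.

(** On [-1/2, 1/2] the weight is at least (3/4)^a. *)
Lemma sqint_one a : 0 <= a -> sqint a 1 != 0.
Proof.
move=> a0; apply: lt0r_neq0.
rewrite -lte_fin -sqintE//.
pose c := (3 / 4 : R) `^ a.
have c0 : 0 < c by rewrite powR_gt0.
have sub : `[(- (1 / 2) : R), 1 / 2] `<=` `[(-1:R), 1].
  by move=> x /=; rewrite !in_itv /= => /andP[? ?]; apply/andP; split; lra.
have /integrableP[mf _] := poly_sqweight_integrable 1 a0.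
have f0 (x : R) : (0 <= ((1 : {poly R}).[x] * sqweight a x)%:E)%E.
  by rewrite lee_fin hornerC mul1r powR_ge0.
apply: (@lt_le_trans _ _ (\int[mu]_(x in `[(- (1 / 2))%R, (1 / 2)%R]) (c%:E))%E).
  rewrite integral_cst//= lebesgue_measure_itv /= lte_fin.
  rewrite ifT; last by lra.
  by rewrite -EFinB -EFinM lte_fin mulr_gt0//; lra.
apply: (@le_trans _ _ (\int[mu]_(x in `[(- (1 / 2))%R, (1 / 2)%R])
  ((1 : {poly R}).[x] * sqweight a x)%R%:E)%E); last first.
  by apply: ge0_subset_integral.
apply: ge0_le_integral => //.
- by move=> x _; rewrite lee_fin ltW.
- exact: measurable_funS mf.
- move=> x /=; rewrite in_itv /= => /andP[h1 h2]; rewrite lee_fin hornerC mul1r.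
  have h3 : 0 <= (1 / 2 - x) * (1 / 2 + x) by rewrite mulr_ge0//; lra.
  by rewrite /c /sqweight ge0_ler_powR ?nnegrE//; lra.
Qed.

End Weight.

(** * Jacobi polynomials in terms of the recurrences *)

Section Jacobi.
Variable R : realType.
Implicit Types (p q : {poly R}) (a l : R).
Let mu := (@lebesgue_measure R).

Lemma sqweight_end a (x : R) : x ^+ 2 = 1 -> 0 <= a -> sqweight (a + 1) x = 0.
Proof. by move=> x1 a0; rewrite /sqweight x1 subrr powR0//; apply: lt0r_neq0; lra. Qed.

(** Subtracting the differential equations of the two polynomials, each
    multiplied by the other polynomial. *)
Lemma ultra_wronskian l i j : 1 / 2 <= l ->
  let W := (ultra l i)^`() * ultra l j - ultra l i * (ultra l j)^`() in
  let k n : R := n%:R * (n%:R + 2 * l) in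
  (1 - 'X ^+ 2) * W^`() - ((2 * l + 1)%:P * 'X) * W = (k j - k i) *: (ultra l i * ultra l j).
Proof.
move=> hl W k.
have kP n : (k n)%:P = n%:R * (n%:R + (2 * l)%:P) :> {poly R}.
  by rewrite /k polyCM polyCD rmorph_nat.
have := ultra_ode i hl; have := ultra_ode j hl; cbv zeta.
rewrite -mul_polyC polyCB !kP polyCD /W.
move: (ultra l i) (ultra l j) => p q oj oi.
rewrite derivB !derivM.
have -> : (1 - 'X ^+ 2) * (p^`()^`() * q + p^`() * q^`() - (p^`() * q^`() + p * q^`()^`())) =
  ((1 - 'X ^+ 2) * p^`()^`()) * q - p * ((1 - 'X ^+ 2) * q^`()^`()) by ring.
by rewrite oi oj; ring.
Qed.

(** By [ultra_wronskian], W (1 - x^2)^(a+1) is a primitive of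
    (k_j - k_i) p_i p_j (1 - x^2)^a, because 2 l + 1 = 2 (a + 1); it vanishes
    at 1 and at -1. *)
Lemma ultra_orth a i j : 0 <= a -> i != j ->
  sqint a (ultra (a + 1 / 2) i * ultra (a + 1 / 2) j) = 0.
Proof.
move=> a0 ij; set l := a + 1 / 2.
have hl : 1 / 2 <= l by rewrite /l; lra.
pose k n : R := n%:R * (n%:R + 2 * l).
have kij : k j - k i != 0.
  have -> : k j - k i = (j%:R - i%:R) * (j%:R + i%:R + 2 * l) by rewrite /k; ring.
  rewrite mulf_neq0//; first by rewrite subr_eq0 eqr_nat eq_sym.
  have i0 : 0 <= i%:R :> R by []; have j0 : 0 <= j%:R :> R by [].
  by apply: lt0r_neq0; lra.
apply: (mulfI kij); rewrite mulr0 -linear_formZ; last exact: sqint_linear.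
have := ultra_wronskian i j hl; cbv zeta.
set W := _ - ultra l i * _ => hW; rewrite -/(k i) -/(k j) in hW.
set S := _ *: _ in hW *.
pose F (x : R) := W.[x] * sqweight (a + 1) x.
have a1 : 0 <= a + 1 by lra.
have dF (x : R) : -1 < x < 1 -> is_derive x 1 F (S.[x] * sqweight a x).
  move=> hx; have d1 := sqweight_derive (a + 1) hx.
  have dW : is_derive x 1 (horner W) W^`().[x] by exact: is_derive_poly.
  rewrite /F; apply: is_derive_eq.
  rewrite -hW addrK /GRing.scale /=.
  have w1 : sqweight (a + 1) x = (1 - x ^+ 2) * sqweight a x.
    case/andP: hx => h1 h2; have h0 : 0 < 1 - x ^+ 2 by nra.
    rewrite /sqweight powRD; last by apply/implyP => _; rewrite gt_eqF.
    by rewrite powRr1 1?mulrC// ltW.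
  rewrite w1 /sqweight !hornerE /=.
  have -> : 2 * l + 1 = 2 * (a + 1) by rewrite /l; lra.
  by ring.
suff : (sqint a S)%:E = 0%:E :> \bar R by case.
rewrite -sqintE//.
rewrite (@continuous_FTC2 R (fun x => S.[x] * sqweight a x) F (-1) 1).
- by rewrite /F !sqweight_end// ?mulr0 ?subee// ?sqrrN expr1n.
- by lra.
- exact: poly_sqweight_continuous.
- split.
  + by move=> x; rewrite in_itv /= => /dF[].
  + apply: cvgM; first exact: (cvg_at_right_filter (@continuous_horner _ W _)).
    exact: sqweight_right.
  + apply: cvgM; first exact: (cvg_at_left_filter (@continuous_horner _ W _)).
    exact: sqweight_left.
- by move=> x; rewrite in_itv /= => /dF d; rewrite derive1E; exact: derive_val.
Qed.

Lemma jacobi_weight_sym a (x : R) : -1 <= x <= 1 -> jacobi_weight a a x = sqweight a x.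
Proof.
move=> /andP[h1 h2]; rewrite /jacobi_weight /sqweight -powRM; [|lra|lra].
by congr (_ `^ _); ring.
Qed.

Lemma jacobi_weight_shift a (x : R) : 0 <= a -> -1 <= x <= 1 ->
  jacobi_weight (a + 1) a x = (1 - x) * sqweight a x.
Proof.
move=> a0 hx; rewrite -jacobi_weight_sym// /jacobi_weight.
rewrite powRD; last by apply/implyP => /eqP; lra.
by case/andP: hx => h1 h2; rewrite powRr1; [ring|lra].
Qed.

(** A rescaling of B satisfies the definition of the Jacobi polynomials, so
    that definition is inhabited; the sequence selected by it is proportional
    to B by [orth_unique], and the normalization at 1 removes the factor. *)
Lemma jacobiR_identify a b (L : {poly R} -> R) (B : nat -> {poly R}) n :
  0 <= a -> linear_form L ->
  (forall p, (\int[mu]_(x in `[(-1)%R, 1%R]) (p.[x] * jacobi_weight a b x)%R%:E = (L p)%:E)%E)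
    ->
  (forall j, size (B j) = j.+1) ->
  (forall i j, i != j -> L (B i * B j) = 0) ->
  (forall j, L (B j * B j) != 0) -> (forall j, (B j).[1] != 0) ->
  jacobiR a b n = ((B n).[1])^-1 *: B n.
Proof.
move=> a0 lin intE sB oB nB B1.
pose v n : R := \prod_(i < n) ((a + i.+1%:R) / i.+1%:R).
have v0 k : v k != 0.
  apply/prodf_neq0 => i _; apply: lt0r_neq0; rewrite divr_gt0//.
  by rewrite (lt_le_trans (_ : 0 < i.+1%:R))// lerDr.
have orthE (P : nat -> {poly R}) i j :
  (\int[mu]_(x in `[(-1)%R, 1%R]) ((P i).[x] * (P j).[x] * jacobi_weight a b x)%R%:E =
    (L (P i * P j))%:E)%E.
  by rewrite -intE; apply: eq_integral => x _; rewrite hornerM.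
have [sP oP P1] : is_jacobi a b (jacobi a b).
  apply: xgetPex; exists (fun k => (v k / (B k).[1]) *: B k); split.
  - move=> k; rewrite size_scale ?sB//.
    by rewrite mulf_neq0// invr_neq0.
  - move=> i j ij; rewrite (orthE (fun k => (v k / (B k).[1]) *: B k)).
    rewrite -scalerAl -scalerAr !(linear_formZ _ _ lin) oB//.
    by rewrite !mulr0.
  - by move=> k; rewrite hornerZ divfK.
have oP' i j : i != j -> L (jacobi a b i * jacobi a b j) = 0.
  by move=> ij; have := oP _ _ ij; rewrite orthE => -[].
have [c Pn] := orth_unique n lin sB sP oB oP' nB.
rewrite /jacobiR Pn hornerZ; have := P1 n; rewrite Pn hornerZ -/(v n) => cB.
have c0 : c != 0 by apply: contraNneq (v0 n) => c0; rewrite -cB c0 mul0r.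
by rewrite scalerA invfM mulrAC mulVf// mul1r.
Qed.

Lemma jacobiR_sym a n : 0 <= a -> jacobiR a a n = ultra (a + 1 / 2) n.
Proof.
move=> a0; set l := a + 1 / 2; have hl : 1 / 2 <= l by rewrite /l; lra.
have l0 : 0 < l by lra.
have lin := sqint_linear a0.
have orth i j : i != j -> sqint a (ultra l i * ultra l j) = 0 by exact: ultra_orth.
rewrite (@jacobiR_identify a a (sqint a) (ultra l) n) ?ultra_at1 ?invr1 ?scale1r//.
- move=> p; rewrite -sqintE//; apply: eq_integral => x; rewrite inE /= in_itv /= => hx.
  by rewrite jacobi_weight_sym.
- by move=> j; exact: size_ultra.
- by move=> j; apply: ultra_norm => //; exact: sqint_one.
- by move=> j; rewrite ultra_at1// oner_neq0.
Qed.

Lemma jacobiR_shift a n : 0 <= a -> (forall j, (ujac (a + 1 / 2) j).[1] != 0) ->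
  jacobiR (a + 1) a n = ((ujac (a + 1 / 2) n).[1])^-1 *: ujac (a + 1 / 2) n.
Proof.
move=> a0; set l := a + 1 / 2 => J1; have hl : 1 / 2 <= l by rewrite /l; lra.
have l0 : 0 < l by lra.
have lin := sqint_linear a0.
have orth i j : i != j -> sqint a (ultra l i * ultra l j) = 0 by exact: ultra_orth.
have [oJ nJ] := ujac_orth hl lin orth (sqint_one a0).
apply: (@jacobiR_identify (a + 1) a (fun p => sqint a ((1 - 'X) * p))) => //; first lra.
- by move=> c p q; rewrite mulrDr -scalerAr lin.
- move=> p; rewrite -sqintE//; apply: eq_integral => x; rewrite inE /= in_itv /= => hx.
  rewrite jacobi_weight_shift// hornerM hornerD hornerN hornerX hornerC.
  by congr EFin; ring.
- by move=> j; exact: size_ujac.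
Qed.

End Jacobi.

(** * The largest zeros and the sign of consecutive differences *)

Section Zeros.
Variable R : realType.
Implicit Types (p q : {poly R}) (a l x y z : R).

Lemma ujac0 l x : (ujac l 0).[x] = 1.
Proof. by rewrite /ujac recpoly0 hornerC. Qed.

Lemma ujac_at1 l n : 0 < l -> (ujac l n).[1] = (2 * n%:R + 2 * l + 1) / (2 * l + 1).
Proof.
move=> l0; have h0 : 2 * l + 1 != 0 by nz.
suff : forall n, (ujac l n).[1] = (2 * n%:R + 2 * l + 1) / (2 * l + 1) /\
   (ujac l n.+1).[1] = (2 * n.+1%:R + 2 * l + 1) / (2 * l + 1) by move=> /(_ n)[].
elim=> [|k [ih1 ih2]].
  split; first by rewrite ujac0 mulr0 add0r divff.
  have h1 : (1 + 2 * l) / (1 + l) != 0 by apply: lt0r_neq0; rewrite divr_gt0//; lra.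
  by apply: (mulfI h1); rewrite ujac1//; field; nz.
split=> //; have := ujac_rec 1 k l0; rewrite ih1 ih2.
have -> : k%:R = k.+1%:R - 1 :> R by rewrite -natr1 addrK.
rewrite -[k.+2%:R]natr1.
have : 0 < k.+1%:R :> R by [].
move: (k.+1%:R : R) ((ujac l k.+2).[1]) => b v b0 h.
have h1 : (b + 2 * l + 1) / (b + l + 1) != 0 by apply: lt0r_neq0; rewrite divr_gt0//; lra.
apply: (mulfI h1).
have -> : (b + 2 * l + 1) / (b + l + 1) * v =
  (2 * 1 + l / ((b + l) * (b + l + 1))) * ((2 * b + 2 * l + 1) / (2 * l + 1)) -
  b / (b + l) * ((2 * (b - 1) + 2 * l + 1) / (2 * l + 1)) by apply/eqP;
    rewrite eq_sym subr_eq h.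
by field; nz.
Qed.

Lemma ujac_gt0 l n y : 1 / 2 <= l -> 1 <= y -> 0 < (ujac l n).[y].
Proof.
move=> hl; have l0 : 0 < l by lra.
rewrite le_eqVlt => /orP[/eqP<-|y1].
  have n0 : 0 <= n%:R :> R by [].
  by rewrite ujac_at1// divr_gt0//; lra.
have [_ e0 e1 uS] := ultra_seqP y hl.
have : 0 < (ultra l n).[y] /\ 0 < (ultra l n.+1).[y] - (ultra l n).[y].
  elim: n => [|n [ih1 ih2]]; first by rewrite e0 e1; lra.
  split; first lra.
  have n0 : 0 < n.+1%:R :> R by [].
  have h : 0 < n.+1%:R + 2 * l by lra.
  rewrite -(pmulr_rgt0 _ h) mulrBr uS.
  have -> : 2 * (n.+1%:R + l) * y * (ultra l n.+1).[y] - n.+1%:R * (ultra l n).[y] -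
     (n.+1%:R + 2 * l) * (ultra l n.+1).[y] =
     n.+1%:R * ((ultra l n.+1).[y] - (ultra l n).[y]) +
     2 * (n.+1%:R + l) * ((y - 1) * (ultra l n.+1).[y]) by ring.
  by rewrite addr_gt0// !mulr_gt0//; lra.
move=> [_]; have := ultra_diff y n hl => h1 h2.
have : 0 < (y - 1) * (ujac l n).[y] by lra.
by rewrite pmulr_rgt0; lra.
Qed.

(** By induction on the size, dividing by the linear factor of the known
    root. *)
Lemma largest_zero_exists p z : p != 0 -> root p z -> exists t, is_largest_zero p t.
Proof.
move: {2}(size p) (leqnn (size p)) => n; elim: n p z => [|n ih] p z sp p0 rz.
  by move: sp; rewrite leqn0 size_poly_eq0 (negPf p0).
have [q pE] := factor_theorem p z rz.
have q0 : q != 0 by apply: contraNneq p0 => q0; rewrite pE q0 mul0r.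
have sq : (size q <= n)%N.
  by move: sp; rewrite pE size_Mmonic ?monicXsubC// size_XsubC addn2.
have [[t rt]|nr] := pselect (exists t, root q t).
  have [s [rs smax]] := ih q t sq q0 rt.
  exists (Num.max s z); split.
    rewrite pE rootM root_XsubC; case: (leP s z) => _; first by rewrite eqxx orbT.
    by rewrite rs.
  move=> y; rewrite pE rootM root_XsubC => /orP[/smax ys|/eqP->].
    by rewrite le_max ys.
  by rewrite le_max lexx orbT.
exists z; split=> // y; rewrite pE rootM root_XsubC => /orP[ry|/eqP->//].
by exfalso; apply: nr; exists y.
Qed.

Lemma largest_zero_ge0 p z x : (forall y, 1 <= y -> 0 < p.[y]) ->
  is_largest_zero p z -> z <= x -> 0 <= p.[x].
Proof.
move=> pos [rz zmax] zx; rewrite leNgt; apply/negP => px.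
have x1 : x <= 1 by rewrite leNgt; apply/negP => /ltW /pos; lra.
have [|r /andP[xr r1] rr] := @poly_ivt _ p x 1 x1; first by rewrite (ltW px) ltW// pos.
have := zmax r rr; move=> rz'.
have rx : r = x by apply/eqP; rewrite eq_le xr (le_trans rz').
by move: rr; rewrite rx /root => /eqP; lra.
Qed.

Lemma largest_zero_gt0 p z x : (forall y, 1 <= y -> 0 < p.[y]) ->
  is_largest_zero p z -> z < x -> 0 < p.[x].
Proof.
move=> pos hz zx; rewrite lt_neqAle (largest_zero_ge0 pos hz (ltW zx)) andbT eq_sym.
by apply/negP => rx; have := hz.2 x rx; rewrite leNgt zx.
Qed.

(** Induction along the interlacing of the zeros. At xi_(n+1) the recurrence
    says that a positive combination of the values of index n and n + 2 is
    zero; the first value is positive, so the second is negative, and the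
    polynomial of index n + 2 has a zero between xi_(n+1) and 1. *)
Lemma xiP a n : 0 <= a -> let l := a + 1 / 2 in
  [/\ is_largest_zero (ujac l n.+1) (xi a n.+1), xi a n < xi a n.+1 & xi a n.+1 < 1].
Proof.
move=> a0 l; have hl : 1 / 2 <= l by rewrite /l; lra.
have l0 : 0 < l by lra.
have J1 j : (ujac l j).[1] != 0 by rewrite gt_eqF// ujac_gt0.
have pos j y : 1 <= y -> 0 < (ujac l j).[y] by exact: ujac_gt0.
have xiE j : (exists z, root (ujac l j.+1) z) -> is_largest_zero (ujac l j.+1) (xi a j.+1).
  move=> [z rz].
  have J0 : ujac l j.+1 != 0 by rewrite -size_poly_eq0 size_ujac.
  have e : is_largest_zero (jacobiR (a + 1) a j.+1) = is_largest_zero (ujac l j.+1).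
    rewrite jacobiR_shift// -/l; apply/funext => t; rewrite /is_largest_zero.
    have rE y : root ((ujac l j.+1).[1]^-1 *: ujac l j.+1) y = root (ujac l j.+1) y.
      by rewrite rootZ// invr_neq0.
    by rewrite rE; congr (_ /\ _); apply/propext; split=> h y; have := h y; rewrite rE.
  have [t ht] := largest_zero_exists J0 rz.
  rewrite /xi /largest_zero e; apply: (@xgetPex _ 0 [set s | is_largest_zero (ujac l j.+1) s]).
  by exists t.
have step j : (ujac l j.+1).[xi a j] < 0 -> xi a j < 1 ->
    [/\ is_largest_zero (ujac l j.+1) (xi a j.+1), xi a j < xi a j.+1 & xi a j.+1 < 1].
  move=> neg lt1.
  have [|r /andP[xr r1] rr] := @poly_ivt _ (ujac l j.+1) (xi a j) 1 (ltW lt1).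
    by rewrite (ltW neg) ltW// pos.
  have hz := xiE j (ex_intro _ r rr).
  split=> //.
    apply: lt_le_trans (hz.2 r rr); rewrite lt_neqAle xr andbT.
    by apply: contraTneq rr => <-; rewrite /root lt_eqF.
  rewrite ltNge; apply/negP => /(pos j.+1); rewrite lt0r.
  by case: hz => /eqP-> _; rewrite eqxx.
suff : (forall y, xi a n < y -> 0 < (ujac l n).[y]) /\
    [/\ is_largest_zero (ujac l n.+1) (xi a n.+1), xi a n < xi a n.+1 & xi a n.+1 < 1].
  by case.
elim: n => [|n [Jpos [hz lt lt1]]].
  split; first by move=> y _; rewrite ujac0.
  apply: step; rewrite /xi; last by lra.
  have h1 : 0 < (1 + 2 * l) / (1 + l) by rewrite divr_gt0//; lra.
  rewrite -(pmulr_rlt0 _ h1) ujac1//.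
  have : 1 / (1 + l) < 1 by rewrite ltr_pdivrMr; lra.
  lra.
split; first by move=> y; exact: largest_zero_gt0 (pos n.+1) hz.
apply: step => //.
have := ujac_rec (xi a n.+1) n l0.
have /eqP -> := hz.1; rewrite mulr0.
have n0 : 0 < n.+1%:R :> R by [].
have h1 : 0 < (n.+1%:R + 2 * l + 1) / (n.+1%:R + l + 1) by rewrite divr_gt0//; lra.
have h2 : 0 < n.+1%:R / (n.+1%:R + l) by rewrite divr_gt0//; lra.
have Jn : 0 < (ujac l n).[xi a n.+1] by exact: Jpos.
rewrite -(pmulr_rlt0 _ h1) => h.
by have := mulr_gt0 h2 Jn; lra.
Qed.

Lemma xi_le a m n : 0 <= a -> (m <= n)%N -> xi a m <= xi a n.
Proof.
move=> a0 /subnK <-; elim: (n - m)%N => // k ih.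
by rewrite addSn (le_trans ih)//; have [_ /ltW] := xiP (k + m) a0.
Qed.

Lemma xi_lt1 a n : 0 <= a -> xi a n < 1.
Proof. by move=> a0; case: n => [|n]; [rewrite /xi; lra|case: (xiP n a0)]. Qed.

Lemma ujac_ge0 a n x : 0 <= a -> xi a n <= x -> 0 <= (ujac (a + 1 / 2) n).[x].
Proof.
move=> a0; case: n => [|n]; first by rewrite ujac0.
have hl : 1 / 2 <= a + 1 / 2 by lra.
by case: (xiP n a0) => hz _ _; apply: largest_zero_ge0 hz => y; exact: ujac_gt0.
Qed.

(** The Casoratian V of the values at z = xi_(n+1) and at x <= z satisfies a
    recurrence whose inhomogeneous term is 2 (z - x) times a product of
    nonnegative values: the positivity behind the Christoffel-Darboux
    formula. At the last index V is minus the product of the wanted value and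
    a positive one. *)
Lemma ujac_le0 a n x : 0 <= a -> xi a n <= x <= xi a n.+1 ->
  (ujac (a + 1 / 2) n.+1).[x] <= 0.
Proof.
move=> a0 /andP[nx xn]; set l := a + 1 / 2; set z := xi a n.+1 in xn *.
have hl : 1 / 2 <= l by rewrite /l; lra.
have l0 : 0 < l by lra.
have [hz ltz _] := xiP n a0; rewrite -/l -/z in hz ltz.
have Jx j : (j <= n)%N -> 0 <= (ujac l j).[x].
  by move=> jn; apply: ujac_ge0 => //; apply: le_trans nx; exact: xi_le.
have Jz j : (j <= n)%N -> 0 <= (ujac l j).[z].
  by move=> jn; apply: ujac_ge0 => //; apply: le_trans (ltW ltz); exact: xi_le.
pose V j := (ujac l j.+1).[z] * (ujac l j).[x] - (ujac l j).[z] * (ujac l j.+1).[x].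
have V0 j : (j <= n)%N -> 0 <= V j.
  elim: j => [|j ih] jn.
    have h1 : 0 < (1 + 2 * l) / (1 + l) by rewrite divr_gt0//; lra.
    rewrite -(pmulr_rge0 _ h1) /V !ujac0 mulr1 mul1r mulrBr !ujac1//; lra.
  have n0 : 0 < j.+1%:R :> R by [].
  have h1 : 0 < (j.+1%:R + 2 * l + 1) / (j.+1%:R + l + 1) by rewrite divr_gt0//; lra.
  have h2 : 0 <= j.+1%:R / (j.+1%:R + l) by rewrite divr_ge0//; lra.
  rewrite -(pmulr_rge0 _ h1).
  have rz := ujac_rec z j l0; have rx := ujac_rec x j l0.
  have := mulr_ge0 (Jz _ jn) (Jx _ jn).
  have := mulr_ge0 h2 (ih (ltnW jn)); rewrite /V.
  move: rz rx; move: (_ / _) (j.+1%:R / _) (l / _) => A C B.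
  move: (ujac l j.+2).[z] (ujac l j.+2).[x] (ujac l j.+1).[z] (ujac l j.+1).[x]
        (ujac l j).[z] (ujac l j).[x] => z2 x2 z1 y1 z0 x0 rz rx c1 c2.
  have -> : A * (z2 * y1 - z1 * x2) = (A * z2) * y1 - z1 * (A * x2) by ring.
  have -> : A * z2 = (2 * z + B) * z1 - C * z0 by rewrite -rz; ring.
  have -> : A * x2 = (2 * x + B) * y1 - C * x0 by rewrite -rx; ring.
  have : 0 <= (z - x) * (z1 * y1) by rewrite mulr_ge0//; lra.
  lra.
have := V0 n (leqnn n); rewrite /V; have /eqP -> := hz.1.
have zn : 0 < (ujac l n).[z].
  case: n {nx Jx Jz V V0 hz xn} @z ltz => [|n] z ltz; first by rewrite ujac0.
  have [hn _ _] := xiP n a0.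
  by apply: largest_zero_gt0 hn ltz => y; exact: ujac_gt0.
by rewrite mul0r sub0r oppr_ge0 pmulr_rle0.
Qed.

End Zeros.

Theorem theorem1p1 (R : realType) (alpha : R) (k : nat) (x : R)
  (halpha : 0 <= alpha) (hk : (1 <= k)%N)
  (hx : xi alpha k.-1 <= x <= xi alpha k) :
  is_minimum (range (fun n : nat => (jacobiR alpha alpha n).[x]))
    (jacobiR alpha alpha k).[x].
Proof.
split; first by exists k.
move=> _ [n _ <-]; rewrite !jacobiR_sym//.
set l := alpha + 1 / 2; have hl : 1 / 2 <= l by rewrite /l; lra.
case/andP: hx => xk1 xk.
have x1 : x < 1 by apply: le_lt_trans xk _; exact: xi_lt1.
have xN1 : -1 <= x by apply: le_trans xk1; exact: (xi_le (m := 0)).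
have x1' : 0 <= 1 - x by lra.
have hu := ultra_seqP x hl.
apply: (trough_min (k := k) n hu) => //; first by rewrite xN1.
  move=> i ik; rewrite -subr_ge0 ultra_diff// mulr_ge0// ujac_ge0//.
  by apply: le_trans xk1; apply: xi_le => //; rewrite -ltnS prednK.
have := ultra_diff x k hl.
case: k hk xk xk1 => // k _ xk xk1 d.
have Jk : (ujac l k.+1).[x] <= 0 by apply: ujac_le0 => //; rewrite xk1.
by rewrite -subr_le0 d mulr_ge0_le0.
Qed.
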